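(* The decision problem \textsc{Reformability} is in P for two agents with identical utilities (i.e., when restricted to instances with $n=2$ agents and $u_1=u_2$).
   Context: Let $N=\{1,\dots,n\}$ be a set of $n\ge 2$ agents and $M$ a set of $m\ge 1$ indivisible goods. Each agent $i$ has an additive utility function $u_i:2^M\to\mathbb{R}_{\ge 0}$, i.e., $u_i(M')=\sum_{g\in M'}u_i(\{g\})$ for all $M'\subseteq M$. An instance consists of $N$, $M$ and $(u_i)_{i\in N}$. Utilities are identical if $u_i=u_j$ for all $i,j\in N$. An allocation $\mathcal{A}=(A_1,\dots,A_n)$ is an ordered partition of $M$ into $n$ (possibly empty) bundles, with $A_i$ allocated to agent $i$. A size vector is a vector $\vec{s}=(s_1,\dots,s_n)$ of non-negative integers with $\sum_{i\in N} s_i=m$; $\mathcal{A}$ has size vector $\vec{s}$ if $|A_i|=s_i$ for all $i\in N$. Agent $i$ is EF1 towards agent $j$ in $\mathcal{A}$ if $A_j=\varnothing$ or there exists $g\in A_j$ with $u_i(A_i)\ge u_i(A_j\setminus\{g\})$. $\mathcal{A}$ is EF1 if every agent is EF1 towards every other agent. \textsc{Reformability}: given an instance and a size vector $\vec{s}$, decide whether there exists an EF1 allocation with size vector $\vec{s}$ in the instance. *)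

(* Defs.v *)
From HB Require Import structures.
From mathcomp Require Import all_boot all_order all_algebra.

Set Implicit Arguments.
Unset Strict Implicit.
Unset Printing Implicit Defensive.

Import Order.TTheory GRing.Theory Num.Theory.

(** * Deterministic multi-tape Turing machines and the class P *)

Inductive move := MoveLeft | MoveRight | Stay.

(* A two-way infinite tape: the cells on the left of the head (nearest first),
   the scanned cell, and the cells on its right.  Cells beyond both lists are
   blank, the blank being [None]. *)
Record tape (C : Type) := Tape {
  tape_left : seq (option C);
  tape_scan : option C;
  tape_right : seq (option C)
}.

Definition blank_tape (C : Type) : tape C := Tape [::] None [::].

Definition tape_of (C : Type) (w : seq C) : tape C :=
  if w is a :: w' then Tape [::] (Some a) (map Some w') else blank_tape C.

Definition write_move (C : Type) (a : option C) (d : move) (t : tape C) :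
    tape C :=
  let l := tape_left t in
  let r := tape_right t in
  match d with
  | MoveLeft => Tape (behead l) (head None l) (a :: r)
  | MoveRight => Tape (a :: l) (head None r) (behead r)
  | Stay => Tape l a r
  end.

(* The tape alphabet consists of the blank, the input symbols (in [Sigma]) and
   the auxiliary symbols (in [work]).  A state [q] is halting when
   [verdict q = Some b], and the machine then accepts iff [b] is true. *)
Record machine (Sigma : finType) := Machine {
  work : finType;
  state : finType;
  extra_tapes : nat;
  start : state;
  verdict : state -> option bool;
  trans : state -> {ffun 'I_extra_tapes.+1 -> option (Sigma + work)} ->
          state * {ffun 'I_extra_tapes.+1 -> option (Sigma + work) * move}
}.

Section Runs.

Variables (Sigma : finType) (M : machine Sigma).

Definition config : Type :=
  state M * {ffun 'I_(extra_tapes M).+1 -> tape (Sigma + work M)}.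

Definition initial (w : seq Sigma) : config :=
  (start M,
   [ffun i => if i == ord0 then tape_of (map inl w) else blank_tape _]).

Definition step (c : config) : config :=
  if verdict c.1 is Some _ then c else
  let qa := trans c.1 [ffun i => tape_scan (c.2 i)] in
  (qa.1, [ffun i => write_move (qa.2 i).1 (qa.2 i).2 (c.2 i)]).

(* As [step] leaves halted configurations unchanged, this says that [M] halts
   on [w] after at most [t] steps, with answer [b]. *)
Definition answers_within (w : seq Sigma) (t : nat) (b : bool) : Prop :=
  verdict (iter t step (initial w)).1 = Some b.

End Runs.

Definition in_P (Sigma : finType) (L : seq Sigma -> Prop) : Prop :=
  exists (M : machine Sigma) (c k : nat),
    forall w : seq Sigma, exists b : bool,
      answers_within M w (c * size w ^ k + c) b /\ (b = true <-> L w).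

(** * Instances, allocations and EF1 *)

Local Open Scope ring_scope.

Record instance (R : realFieldType) (n m : nat) := Instance {
  util : 'I_n -> {set 'I_m} -> R;
  util_ge0 : forall i B, 0 <= util i B;
  util_additive : forall i B, util i B = \sum_(g in B) util i [set g]
}.

Definition identical (R : realFieldType) (n m : nat) (I : instance R n m) :
    Prop :=
  forall i j B, util I i B = util I j B.

(* Ordered partition of the goods, with possibly empty bundles. *)
Definition allocation (n m : nat) (A : 'I_n -> {set 'I_m}) : Prop :=
  (forall i j, i != j -> [disjoint A i & A j]) /\ \bigcup_i A i = [set: 'I_m].

Definition EF1_towards (R : realFieldType) (n m : nat) (I : instance R n m)
    (A : 'I_n -> {set 'I_m}) (i j : 'I_n) : Prop :=
  A j = set0 \/ exists2 g, g \in A j & util I i (A i) >= util I i (A j :\ g).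

Definition EF1 (R : realFieldType) (n m : nat) (I : instance R n m)
    (A : 'I_n -> {set 'I_m}) : Prop :=
  forall i j, i != j -> EF1_towards I A i j.

Definition size_vector (n m : nat) (s : 'I_n -> nat) : Prop :=
  (\sum_i s i = m)%N.

Definition has_size_vector (n m : nat) (A : 'I_n -> {set 'I_m})
    (s : 'I_n -> nat) : Prop :=
  forall i, #|A i| = s i.

Definition reformable (R : realFieldType) (n m : nat) (I : instance R n m)
    (s : 'I_n -> nat) : Prop :=
  exists A : 'I_n -> {set 'I_m},
    [/\ allocation A, has_size_vector A s & EF1 I A].

(** * Encoding of the inputs as words *)

Inductive symbol := Bit of bool | Slash | Comma | Semicolon.

Definition symbol_code (x : symbol) : option (option (option bool)) :=
  match x with
  | Bit b => Some (Some (Some b))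
  | Slash => Some (Some None)
  | Comma => Some None
  | Semicolon => None
  end.

Definition symbol_decode (x : option (option (option bool))) : symbol :=
  match x with
  | Some (Some (Some b)) => Bit b
  | Some (Some None) => Slash
  | Some None => Comma
  | None => Semicolon
  end.

Lemma symbol_codeK : cancel symbol_code symbol_decode.
Proof. by case. Qed.

HB.instance Definition _ := Finite.copy symbol (can_type symbol_codeK).

(* Binary notation, least significant bit first, without superfluous zeros;
   0 is written as a single zero. *)
Definition binary (x : nat) : seq symbol :=
  mkseq (fun k => Bit (odd (x %/ 2 ^ k))) (trunc_log 2 x).+1.

Definition encoding (n m : nat) (num den : 'I_n -> 'I_m -> nat)
    (s : 'I_n -> nat) : seq symbol :=
  flatten [seq
    flatten [seq binary (num i g) ++ Slash :: binary (den i g) ++ [:: Comma]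
            | g <- enum 'I_m] ++ [:: Semicolon]
    | i <- enum 'I_n] ++
  flatten [seq binary (s i) ++ [:: Comma] | i <- enum 'I_n].

(* [w] lists the utilities of the single goods, one row per agent, as
   fractions (not necessarily in lowest terms), and then the size vector.
   Thus the instances that have an encoding are those with rational
   utilities. *)
Definition encodes (R : realFieldType) (n m : nat) (w : seq symbol)
    (I : instance R n m) (s : 'I_n -> nat) : Prop :=
  exists num den : 'I_n -> 'I_m -> nat,
    (forall i g, (0 < den i g)%N /\
       util I i [set g] = (num i g)%:R / (den i g)%:R) /\
    w = encoding num den s.

(** * The decision problem *)

(* The language of the encodings of the yes-instances of Reformability that
   belong to the class [K]. *)
Definition Reformability (R : realFieldType)
    (K : forall n m : nat, instance R n m -> Prop) (w : seq symbol) : Prop :=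
  exists (n m : nat) (I : instance R n m) (s : 'I_n -> nat),
    [/\ (2 <= n)%N /\ (1 <= m)%N, size_vector m s, K n m I, encodes w I s &
        reformable I s].

Definition two_identical_agents (R : realFieldType) (n m : nat)
    (I : instance R n m) : Prop :=
  n = 2%N /\ identical I.

(* Main.v *)
(** Let two agents value the goods by the same [v], and let a bundle [A] be fair
if its owner is EF1 towards the owner of the complement.  Moving a good [a] out
of [A] in exchange for another one keeps [A] fair as long as the complement of
[A] is not fair, since then [A :\ a] alone is worth more than the complement.
Hence an EF1 allocation with sizes [(s1, s2)] exists iff each agent alone can be
made content by some allocation with these sizes.  An optimal bundle of size [s]
against [k] other goods takes the [s] best goods; with [t] the value of the
best remaining good, it is fair iff
  [sum_g v g + 2 k t <= 2 (sum_g max (v g) t) + t],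
and the other values of [t] among the [v g] give weaker inequalities.  So it
suffices to test this inequality for every [t = v g], without sorting.

To run this test on a Turing machine, data are binary trees in Polish notation
on tapes that are used as stacks.  A function on trees is run on the top of a
stack and leaves the rest untouched, so such programs compose, and the functions
that they compute in polynomial time are closed under pairing, case analysis and
iterations along a list whose intermediate results stay polynomially bounded. *)

Require Import Defs.
From HB Require Import structures.
From mathcomp Require Import all_boot all_order all_algebra.
From mathcomp Require Import zify ring lra.

Set Implicit Arguments.
Unset Strict Implicit.
Unset Printing Implicit Defensive.

(** * Records with one field per stack, and polynomial bounds *)

Record five (A : Type) := Five { inp : A; main : A; aux : A; scr : A; cnt : A }.

Definition sel (A : Type) (f : five A) (i : 'I_5) : A :=
  match val i with
  | 0 => inp f | 1 => main f | 2 => aux f | 3 => scr f | _ => cnt f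
  end.

Definition five_of (A : Type) (f : 'I_5 -> A) : five A :=
  Five (f (inord 0)) (f (inord 1)) (f (inord 2)) (f (inord 3)) (f (inord 4)).

Definition five_map2 (A B C : Type) (f : A -> B -> C) (a : five A) (b : five B) :
    five C :=
  Five (f (inp a) (inp b)) (f (main a) (main b)) (f (aux a) (aux b))
       (f (scr a) (scr b)) (f (cnt a) (cnt b)).

Lemma sel_five_of (A : Type) (f : 'I_5 -> A) i : sel (five_of f) i = f i.
Proof.
by case: i => [[|[|[|[|[|//]]]]] p]; congr f; apply/val_inj; rewrite /= inordK.
Qed.

Lemma sel_five_map2 (A B C : Type) (f : A -> B -> C) a b i :
  sel (five_map2 f a b) i = f (sel a i) (sel b i).
Proof. by case: i => [[|[|[|[|[|//]]]]] p]. Qed.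

Lemma five_ext (A : Type) (a b : five A) :
  (forall i, sel a i = sel b i) -> a = b.
Proof.
case: a b => [a0 a1 a2 a3 a4] [b0 b1 b2 b3 b4] eq_ab.
have := eq_ab (@Ordinal 5 0 isT); have := eq_ab (@Ordinal 5 1 isT).
have := eq_ab (@Ordinal 5 2 isT); have := eq_ab (@Ordinal 5 3 isT).
by have := eq_ab (@Ordinal 5 4 isT); rewrite /sel /= => -> -> -> -> ->.
Qed.

(** Monotonicity allows a bound to be applied to an estimate of a size instead of the size itself.
    The base [n.+1] is never 0, so exponents can be raised freely when bounds are added. *)
Definition pbound (p : nat -> nat) : Prop :=
  {homo p : m n / m <= n} /\ exists c k, forall n, p n <= c * n.+1 ^ k.

Lemma leq_expl (m n k : nat) : m <= n -> m ^ k <= n ^ k.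
Proof. by case: k => // k le_mn; rewrite leq_exp2r. Qed.

Lemma pbound_const c : pbound (fun=> c).
Proof. by split=> //; exists c, 0 => n; rewrite expn0 muln1. Qed.

Lemma pbound_id : pbound id.
Proof. by split=> //; exists 1, 1 => n; rewrite mul1n expn1. Qed.

Lemma pboundD p q : pbound p -> pbound q -> pbound (fun n => p n + q n).
Proof.
move=> [hp [c [k lep]]] [hq [d [l leq]]]; split=> [m n le_mn|].
  by rewrite leq_add ?hp ?hq.
exists (c + d), (k + l) => n; rewrite mulnDl leq_add //.
  by rewrite (leq_trans (lep n)) // leq_mul // leq_pexp2l // leq_addr.
by rewrite (leq_trans (leq n)) // leq_mul // leq_pexp2l // leq_addl.
Qed.

Lemma pboundM p q : pbound p -> pbound q -> pbound (fun n => p n * q n).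
Proof.
move=> [hp [c [k lep]]] [hq [d [l leq]]]; split=> [m n le_mn|].
  by rewrite leq_mul ?hp ?hq.
by exists (c * d), (k + l) => n; rewrite expnD mulnACA leq_mul.
Qed.

Lemma pbound_comp p q : pbound p -> pbound q -> pbound (fun n => p (q n)).
Proof.
move=> [hp [c [k lep]]] [hq [d [l leq]]]; split=> [m n le_mn|].
  by apply/hp/hq.
exists (c * d.+1 ^ k), (l * k) => n.
rewrite (leq_trans (lep _)) // -mulnA leq_mul // expnM -expnMn leq_expl //.
by rewrite mulSn -add1n leq_add // expn_gt0.
Qed.

(** Passage to the form of bound used in [in_P]: [n.+1 <= 2 * n] for positive [n] accounts for the
    factor [2 ^ k], and the additive constant covers [n = 0]. *)
Lemma pbound_std p : pbound p -> exists c k, forall n, p n <= c * n ^ k + c.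
Proof.
case=> _ [c [k lep]]; exists (c * 2 ^ k), k => n.
rewrite (leq_trans (lep n)) //; case: n {lep} => [|n].
  by rewrite exp1n muln1 (leq_trans _ (leq_addl _ _)) // leq_pmulr ?expn_gt0.
rewrite (leq_trans _ (leq_addr _ _)) // -mulnA leq_mul // -expnMn leq_expl //.
by rewrite mulSn mul1n addSn addnS !ltnS leq_addr.
Qed.

(** * Stack programs and their simulation by Turing machines *)

Section StackPrograms.

Variable Sigma : finType.

Notation letter := (Sigma + option bool)%type.
Notation stacks := (five (seq letter)).
Notation op := (option (option letter)).
Notation keep := (@None (option letter)).
Notation pop := (Some (@None letter)).
Notation push x := (Some (Some x)).

Definition act (o : op) (s : seq letter) : seq letter :=
  match o with None => s | Some None => behead s | Some (Some x) => x :: s end.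

Definition tops (S : stacks) : five (option letter) :=
  Five (ohead (inp S)) (ohead (main S)) (ohead (aux S)) (ohead (scr S))
       (ohead (cnt S)).

(* A transition to [None] leaves the program. *)
Record prog := Prog {
  pstate : finType;
  pstart : pstate;
  pstep : pstate -> five (option letter) -> option pstate * five op
}.

Inductive run (F : prog) : option (pstate F) -> stacks -> nat -> stacks -> Prop :=
| run_exit S : run None S 0 S
| run_step q S k S' :
    run (pstep q (tops S)).1 (five_map2 act (pstep q (tops S)).2 S) k S' ->
    run (Some q) S k.+1 S'.

Definition exec (F : prog) (S : stacks) (k : nat) (S' : stacks) : Prop :=
  exists2 j, j <= k & run (Some (pstart F)) S j S'.

Lemma exec_le F S k k' S' : exec F S k S' -> k <= k' -> exec F S k' S'.
Proof. by case=> j jk r kk'; exists j => //; apply: leq_trans kk'. Qed.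

(* Comparing the cells with [nth None] identifies missing cells with blanks. *)
Definition tape_rep (t : tape letter) (s : seq letter) : Prop :=
  (forall n, nth None (tape_left t) n = None) /\
  (forall n, nth None (tape_scan t :: tape_right t) n = nth None (map Some s) n).

Definition first_move (o : op) (x : option letter) : option letter * move :=
  match o with
  | None => (x, Stay)
  | Some None => (None, MoveRight)
  | Some (Some _) => (x, MoveLeft)
  end.

Definition second_move (o : op) (x : option letter) : option letter * move :=
  if o is Some (Some y) then (Some y, Stay) else (x, Stay).

Lemma tape_rep_scan t s : tape_rep t s -> tape_scan t = ohead s.
Proof. by case=> _ /(_ 0); case: s. Qed.

(** The top of the stack is the scanned cell, the rest lies to its right, and everything to its left
    is blank. So a move to the left finds a free cell for a push, and erasing before the move to the
    right keeps the left half blank in a pop. *)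
Lemma tape_rep_act o t s (x := tape_scan t)
    (t1 := write_move (first_move o x).1 (first_move o x).2 t)
    (y := tape_scan t1) :
  tape_rep t s ->
  tape_rep (write_move (second_move o y).1 (second_move o y).2 t1) (act o s).
Proof.
rewrite {}/y {}/t1 {}/x; case: t => l x r [/= Hl Hr].
case: o => [[y|]|]; split => n /=.
- by have := Hl n.+1; rewrite nth_behead.
- by case: n.
- by case: n.
- by have := Hr n.+1; case: n => [|n]; case: (s) r {Hr} => [|? ?] [|? ?] //=;
    rewrite ?nth_nil // => <-; rewrite nth_nil.
- exact: Hl.
- exact: Hr.
Qed.

(* Each step of [F] takes two steps of the machine: a push first moves left and
   then writes, a pop erases and moves right.  The operations are remembered in
   the state in between. *)
Definition tm_of (F : prog) : machine Sigma := {|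
  work := option bool;
  state := (option (pstate F) * option {ffun 'I_5 -> op} + bool)%type;
  extra_tapes := 4;
  start := inl (Some (pstart F), None);
  verdict := fun q => if q is inr b then Some b else None;
  trans := fun q r => match q with
    | inl (p, Some o) =>
        (inl (p, None), [ffun i => second_move (o i) (r i)])
    | inl (Some p, None) =>
        let po := pstep p (five_of r) in
        (inl (po.1, Some [ffun i => sel po.2 i]),
         [ffun i => first_move (sel po.2 i) (r i)])
    | inl (None, None) =>
        (inr (r (inord 1) == Some (inr (Some true))), [ffun i => (r i, Stay)])
    | inr b => (inr b, [ffun i => (r i, Stay)])
    end |}.

Definition tapes_rep (ts : 'I_5 -> tape letter) (S : stacks) : Prop :=
  forall i, tape_rep (ts i) (sel S i).

Lemma tops_rep (ts : {ffun 'I_5 -> tape letter}) S :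
  tapes_rep ts S -> five_of [ffun i => tape_scan (ts i)] = tops S.
Proof.
move=> H; apply: five_ext => i; rewrite sel_five_of ffunE (tape_rep_scan (H i)).
by case: i => [[|[|[|[|[|//]]]]] p].
Qed.

Lemma run_tm (F : prog) q S k S' : run q S k S' ->
  forall ts : {ffun 'I_5 -> tape letter}, tapes_rep ts S ->
  exists2 ts' : {ffun 'I_5 -> tape letter}, tapes_rep ts' S' &
    iter k.*2 (@step _ (tm_of F)) (inl (q, None), ts) = (inl (None, None), ts').
Proof.
elim=> {q S k S'} [S|q S k S' _ IH] ts Hts; first by exists ts.
rewrite doubleS !iterSr.
pose qo := pstep q (tops S).
pose ts1 := [ffun i => write_move (first_move (sel qo.2 i) (tape_scan (ts i))).1
  (first_move (sel qo.2 i) (tape_scan (ts i))).2 (ts i)].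
pose ts2 := [ffun i => write_move (second_move (sel qo.2 i) (tape_scan (ts1 i))).1
  (second_move (sel qo.2 i) (tape_scan (ts1 i))).2 (ts1 i)].
have -> : @step _ (tm_of F) (inl (Some q, None), ts) =
    (inl (qo.1, Some [ffun i => sel qo.2 i]), ts1).
  rewrite /step /= (tops_rep Hts); congr pair.
  by apply/ffunP => i; rewrite !ffunE.
have -> : @step _ (tm_of F) (inl (qo.1, Some [ffun i => sel qo.2 i]), ts1) =
    (inl (qo.1, None), ts2).
  rewrite /step /=; case: (qo.1) => [q'|]; congr pair;
  by apply/ffunP => i; rewrite !ffunE.
case: (IH ts2) => [i|ts' H1 H2]; last by exists ts'.
by rewrite sel_five_map2 /ts2 !ffunE; apply: tape_rep_act.
Qed.

Lemma tm_init (F : prog) (w : seq Sigma) :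
  tapes_rep (initial (tm_of F) w).2 (Five (map inl w) [::] [::] [::] [::]).
Proof.
move=> i; rewrite ffunE; case: i => [[|[|[|[|[|//]]]]] p] /=; last 4 first.
- by split => [] [|[]].
- by split => [] [|[]].
- by split => [] [|[]].
- by split => [] [|[]].
by case: w => [|a w]; split => [] [|[|n]].
Qed.

(* The answer is the letter on top of [main]. *)
Lemma exec_decides (F : prog) (d : seq Sigma -> bool) (p : nat -> nat) :
  pbound p ->
  (forall w, exists2 S', ohead (main S') = Some (inr (Some (d w))) &
     exec F (Five (map inl w) [::] [::] [::] [::]) (p (size w)) S') ->
  exists (M : machine Sigma) (c k : nat), forall w,
    answers_within M w (c * size w ^ k + c) (d w).
Proof.
(* Each step of [F] costs two machine steps, and one last step reads the verdict off [main]. *)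
move=> pp H; have pp' : pbound (fun n => 1 + (p n + p n)).
  exact: pboundD (pbound_const 1) (pboundD pp pp).
have [c [k le_ck]] := pbound_std pp'; exists (tm_of F), c, k => w.
have [S' dS' [j le_j runj]] := H w.
have [ts' rep' iter_j] := run_tm runj (tm_init F w).
have /leq_trans/(_ (le_ck _)) : 1 + (j + j) <= 1 + (p (size w) + p (size w)).
  by rewrite leq_add2l leq_add.
rewrite addnn add1n /answers_within => /subnK <-; rewrite iterD iterS.
have -> : initial (tm_of F) w = (inl (Some (pstart F), None), (initial (tm_of F) w).2).
  by [].
rewrite iter_j {2}/step /= ffunE (tape_rep_scan (rep' _)).
have -> : sel S' (inord 1) = main S' by rewrite /sel /= inordK.
rewrite dS'; set c0 := (inr _, _).
(* A halted configuration is a fixed point, so the time left over is harmless. *)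
have step0 : @step _ (tm_of F) c0 = c0 by rewrite /step.
elim: (_ - _) => [|n IH]; last by rewrite iterSr step0.
by congr Some; apply/eqP/idP => [[]|->].
Qed.

(** * Combinators on stack programs *)

(** The exit of [F] is identified with the start of [G]; the switch takes no step of its own, and
    running times simply add. *)
Definition lift_seq (F G : prog) (q : option (pstate F)) :
    option (pstate F + pstate G) :=
  if q is Some q then Some (inl q) else Some (inr (pstart G)).

Definition seqp (F G : prog) : prog :=
  @Prog (pstate F + pstate G)%type (inl (pstart F)) (fun q r =>
    match q with
    | inl q => let qo := pstep q r in (lift_seq G qo.1, qo.2)
    | inr q => let qo := pstep q r in (omap inr qo.1, qo.2)
    end).

Lemma run_seqr F G q S k S' :
  run q S k S' -> @run (seqp F G) (omap inr q) S k S'.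
Proof.
by elim=> {q S k S'} [S|q S k S' _ IH]; [apply: run_exit | apply: run_step].
Qed.

Lemma run_seql F G q S k S' : run q S k S' ->
  forall k' S'', @run (seqp F G) (Some (inr (pstart G))) S' k' S'' ->
  @run (seqp F G) (lift_seq G q) S (k + k') S''.
Proof.
elim=> {q S k S'} [S|q S k S' _ IH] k' S'' H //.
by rewrite addSn; apply: run_step; apply: IH.
Qed.

Lemma exec_seq F G S1 k1 S2 k2 S3 :
  exec F S1 k1 S2 -> exec G S2 k2 S3 -> exec (seqp F G) S1 (k1 + k2) S3.
Proof.
move=> [j1 le1 r1] [j2 le2 r2]; exists (j1 + j2); first exact: leq_add.
exact: (run_seql r1 (run_seqr F r2)).
Qed.

Definition ifp (x : letter) (F G : prog) : prog :=
  @Prog (option (pstate F + pstate G)) None (fun q r =>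
    match q with
    | None => (Some (Some (if main r == Some x then inl (pstart F)
                           else inr (pstart G))),
               Five keep pop keep keep keep)
    | Some (inl q) => let qo := pstep q r in (omap (Some \o inl) qo.1, qo.2)
    | Some (inr q) => let qo := pstep q r in (omap (Some \o inr) qo.1, qo.2)
    end).

Lemma run_ifl x F G q S k S' :
  run q S k S' -> @run (ifp x F G) (omap (Some \o inl) q) S k S'.
Proof.
by elim=> {q S k S'} [S|q S k S' _ IH]; [apply: run_exit | apply: run_step].
Qed.

Lemma run_ifr x F G q S k S' :
  run q S k S' -> @run (ifp x F G) (omap (Some \o inr) q) S k S'.
Proof.
by elim=> {q S k S'} [S|q S k S' _ IH]; [apply: run_exit | apply: run_step].
Qed.

Lemma exec_if x y F G i m a s c k S' :
  exec (if y == x then F else G) (Five i m a s c) k S' ->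
  exec (ifp x F G) (Five i (y :: m) a s c) k.+1 S'.
Proof.
case=> j le_j r; exists j.+1 => //; apply: run_step; rewrite /=.
have -> : (Some y == Some x) = (y == x) by [].
by case: (y == x) r => r; [apply: run_ifl r | apply: run_ifr r].
Qed.

(** Meant for [x = node] and a list on [aux]: a successful test strips the list constructor and
    leaves the next element on top of [aux] for the body, and the failing test removes the
    terminator. *)
Definition whilep (x : letter) (F : prog) : prog :=
  @Prog (option (pstate F)) None (fun q r =>
    match q with
    | None => (if aux r == Some x then Some (Some (pstart F)) else None,
               Five keep keep pop keep keep)
    | Some q => let qo := pstep q r in (Some qo.1, qo.2)
    end).

Lemma exec_while_stop x y F i m a s c : y != x ->
  exec (whilep x F) (Five i m (y :: a) s c) 1 (Five i m a s c).
Proof.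
move=> neq_yx; exists 1 => //; apply: run_step; rewrite /=.
have -> : (Some y == Some x) = (y == x) by [].
by rewrite (negPf neq_yx); apply: run_exit.
Qed.

Lemma run_while x F q S k S' : run q S k S' ->
  forall k' S'', @run (whilep x F) (Some None) S' k' S'' ->
  @run (whilep x F) (Some q) S (k + k') S''.
Proof.
elim=> {q S k S'} [S|q S k S' _ IH] k' S'' H //.
by rewrite addSn; apply: run_step; apply: IH.
Qed.

Lemma exec_while_loop x F i m a s c k S k' S' :
  exec F (Five i m a s c) k S -> exec (whilep x F) S k' S' ->
  exec (whilep x F) (Five i m (x :: a) s c) (k + k').+1 S'.
Proof.
move=> [j le_j r] [j' le_j' r']; exists (j + j').+1.
  by rewrite ltnS leq_add.
apply: run_step; rewrite /= eqxx; exact: (run_while r r').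
Qed.

Definition stepp (f : five (option letter) -> five op) : prog :=
  @Prog unit tt (fun _ r => (None, f r)).

Lemma exec_step f S : exec (stepp f) S 1 (five_map2 act (f (tops S)) S).
Proof. by exists 1 => //; apply: run_step; apply: run_exit. Qed.

Definition pushp (x : letter) : prog :=
  stepp (fun=> Five keep (push x) keep keep keep).

Definition popp : prog := stepp (fun=> Five keep pop keep keep keep).

Lemma exec_push x i m a s c :
  exec (pushp x) (Five i m a s c) 1 (Five i (x :: m) a s c).
Proof. exact: exec_step. Qed.

Lemma exec_pop x i m a s c :
  exec popp (Five i (x :: m) a s c) 1 (Five i m a s c).
Proof. exact: exec_step. Qed.

Definition replacep (f : letter -> letter) : prog :=
  @Prog (option letter) None (fun q r =>
    match q with
    | None => (Some (main r), Five keep pop keep keep keep)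
    | Some x => (None, Five keep (push (f x)) keep keep keep)
    end).

Lemma exec_replace f x i m a s c :
  exec (replacep f) (Five i (x :: m) a s c) 2 (Five i (f x :: m) a s c).
Proof. by exists 2 => //; do 2!apply: run_step => /=; apply: run_exit. Qed.

(** * Trees on the stacks *)

Definition node : letter := inr None.

Definition leaf (x : Sigma + bool) : letter :=
  match x with inl a => inl a | inr b => inr (Some b) end.

Inductive tree := Leaf of Sigma + bool | Node of tree & tree.

(* Polish notation: a tree can be popped without any separator, and [node] is
   all that has to be pushed to pair the two topmost trees of a stack. *)
Fixpoint flat (t : tree) : seq letter :=
  match t with Leaf x => [:: leaf x] | Node t u => node :: flat t ++ flat u end.

(* Moves the topmost tree of [aux] (if [from_aux]) or [main] to [main] and/or
   [aux].  In the first phase the tree is reversed on [scr], and [cnt] holds one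
   letter less than the number of subtrees that remain to be read. *)
Definition movep (from_aux to_main to_aux : bool) : prog :=
  @Prog bool false (fun q r =>
    if q then
      if scr r is Some x then
        (Some true, Five keep (if to_main then push x else keep)
                         (if to_aux then push x else keep) pop keep)
      else (None, Five keep keep keep keep keep)
    else
      if (if from_aux then aux r else main r) is Some x then
        (Some ((x != node) && (cnt r == None)),
         Five keep (if from_aux then keep else pop)
                   (if from_aux then pop else keep) (push x)
              (if x == node then push node else pop))
      else (None, Five keep keep keep keep keep)).

(** Induction on [t] for an arbitrary counter [c], with one letter per subtree awaited after [t].
    Finishing [t] consumes one of them, and the second phase starts exactly when none was left. *)
Lemma run_scan fa ta tm (t : tree) i u v s c k S' :
  @run (movep fa tm ta) (Some (nilp c))
       (Five i (if fa then v else u) (if fa then u else v)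
             (rev (flat t) ++ s) (behead c)) k S' ->
  @run (movep fa tm ta) (Some false)
       (Five i (if fa then v else flat t ++ u) (if fa then flat t ++ u else v)
             s c) (size (flat t) + k) S'.
Proof.
elim: t u s c k S' => [x|t IHt t' IHt'] u s c k S' H.
  rewrite add1n; apply: run_step; rewrite /=.
  have leafN : (leaf x == node) = false by case: (x).
  move: H; rewrite /= /rev /=.
  by case: fa; rewrite /= leafN /=; case: c.
rewrite [size _]/= addSn; apply: run_step; rewrite /=.
(* The [node] just read has put a letter on [cnt]; it stands for [t'] while [t] is scanned. *)
have /IHt : @run (movep fa tm ta) (Some (nilp (node :: c)))
     (Five i (if fa then v else flat t' ++ u) (if fa then flat t' ++ u else v)
       (rev (flat t) ++ node :: s) c) (size (flat t') + k) S'.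
  apply: IHt'; move: H; rewrite /= rev_cons rev_cat -cats1 -!catA.
  by [].
by rewrite size_cat -addnA -!catA; case: (fa).
Qed.

Lemma run_flush fa ta tm w i m a :
  @run (movep fa tm ta) (Some true) (Five i m a w [::]) (size w).+1
     (Five i (if tm then rev w ++ m else m) (if ta then rev w ++ a else a)
           [::] [::]).
Proof.
elim: w m a => [|x w IH] m a.
  by apply: run_step; case: tm; case: ta; apply: run_exit.
apply: run_step; rewrite /= !rev_cons -!cats1 -!catA /=.
by case: tm ta IH => [] [] IH; apply: IH.
Qed.

Lemma exec_move fa ta tm t i u v :
  exec (movep fa tm ta)
    (Five i (if fa then v else flat t ++ u) (if fa then flat t ++ u else v)
          [::] [::]) (2 * size (flat t)).+1
    (Five i ((if tm then flat t else [::]) ++ (if fa then v else u))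
            ((if ta then flat t else [::]) ++ (if fa then u else v))
          [::] [::]).
Proof.
exists (2 * size (flat t)).+1 => //; rewrite mul2n -addnn -addnS.
apply: run_scan; rewrite /= cats0 -[X in (size X).+1]revK size_rev.
have := run_flush fa ta tm (rev (flat t)) i (if fa then v else u) (if fa then u else v).
by rewrite revK; case: tm; case: ta.
Qed.

Lemma exec_copy t i m a :
  exec (movep false true true) (Five i (flat t ++ m) a [::] [::])
    (2 * size (flat t)).+1 (Five i (flat t ++ m) (flat t ++ a) [::] [::]).
Proof. exact: (exec_move false true true). Qed.

Lemma exec_save t i m a :
  exec (movep false false true) (Five i (flat t ++ m) a [::] [::])
    (2 * size (flat t)).+1 (Five i m (flat t ++ a) [::] [::]).
Proof. exact: (exec_move false true false). Qed.

Lemma exec_restore t i m a :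
  exec (movep true true false) (Five i m (flat t ++ a) [::] [::])
    (2 * size (flat t)).+1 (Five i (flat t ++ m) a [::] [::]).
Proof. exact: (exec_move true false true). Qed.

Lemma exec_drop t i m a :
  exec (movep false false false) (Five i (flat t ++ m) a [::] [::])
    (2 * size (flat t)).+1 (Five i m a [::] [::]).
Proof. exact: (exec_move false false false). Qed.

End StackPrograms.

(** * Functions computable in polynomial time *)

Class Encodable (Sigma : finType) (A : Type) := code : A -> tree Sigma.
#[export] Hint Mode Encodable - ! : typeclass_instances.

Ltac pbound_tac :=
  repeat match goal with
  | H : pbound ?p |- pbound ?p => exact: H
  | |- pbound (fun n => n) => exact: pbound_id
  | |- pbound (fun n => ?c) => exact: pbound_const
  | |- pbound (fun n => addn (@?p n) (@?q n)) => apply: (@pboundD p q)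
  | |- pbound (fun n => muln (@?p n) (@?q n)) => apply: (@pboundM p q)
  | H : pbound ?p |- pbound (fun n => ?p (@?q n)) => apply: (@pbound_comp p q)
  end.

Lemma leq_pbound p m n : pbound p -> m <= n -> p m <= p n.
Proof. by case=> + _; apply. Qed.

Section Poly.

Variable Sigma : finType.
Notation Encodable := (Encodable Sigma).
Notation letter := (Sigma + option bool)%type.
Notation node := (node Sigma).
Implicit Types A B C E X : Type.

#[export] Instance code_letter : Encodable Sigma := fun a => Leaf (inl a).
#[export] Instance code_bool : Encodable bool := fun b => Leaf (inr b).
#[export] Instance code_prod A B {eA : Encodable A} {eB : Encodable B} :
  Encodable (A * B) := fun x => Node (code x.1) (code x.2).
(** A right comb ending in a leaf: the first letter tells whether the list is empty, and a nonempty
    list has the same code as the pair of its head and tail. *)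
#[export] Instance code_seq A {eA : Encodable A} : Encodable (seq A) :=
  foldr (fun x t => Node (code x) t) (Leaf (inr false)).

Definition sz A {eA : Encodable A} (x : A) : nat := size (flat (code x)).

(* Whatever lies below the argument on the stacks is preserved: this is what makes
   the closure properties below compositional. *)
Definition polytime A B {eA : Encodable A} {eB : Encodable B} (f : A -> B) : Prop :=
  exists F p, pbound p /\ forall x, sz (f x) <= p (sz x) /\
    forall i m a, exec F (Five i (flat (code x) ++ m) a [::] [::]) (p (sz x))
                         (Five i (flat (code (f x)) ++ m) a [::] [::]).

Lemma flat_pair A B {eA : Encodable A} {eB : Encodable B} (x : A) (y : B) w :
  flat (code (x, y)) ++ w = node :: flat (code x) ++ flat (code y) ++ w.
Proof. by rewrite /= -catA. Qed.

Lemma flat_cons A {eA : Encodable A} (x : A) (s : seq A) w :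
  flat (code (x :: s)) ++ w = node :: flat (code x) ++ flat (code s) ++ w.
Proof. by rewrite /= -catA. Qed.

Lemma sz_pair A B {eA : Encodable A} {eB : Encodable B} (x : A) (y : B) :
  sz (x, y) = (sz x + sz y).+1.
Proof. by rewrite /sz /= size_cat. Qed.

Lemma sz_cons A {eA : Encodable A} (x : A) s : sz (x :: s) = (sz x + sz s).+1.
Proof. by rewrite /sz /= size_cat. Qed.

Lemma sz_nil A {eA : Encodable A} : sz ([::] : seq A) = 1.
Proof. by []. Qed.

Lemma sz_gt0 A {eA : Encodable A} (x : A) : 0 < sz x.
Proof. by rewrite /sz; case: code. Qed.

Lemma sz_cat A {eA : Encodable A} (s1 s2 : seq A) :
  (sz (s1 ++ s2)).+1 = sz s1 + sz s2.
Proof. by elim: s1 => [|x s IH] //=; rewrite !sz_cons addSn -addnA -IH addnS. Qed.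

Lemma sz_bool (b : bool) : sz b = 1. Proof. by []. Qed.
Lemma sz_letter (a : Sigma) : sz a = 1. Proof. by []. Qed.

Lemma sz_mem A {eA : Encodable A} (s1 s2 : seq A) x : sz x < sz (s1 ++ x :: s2).
Proof.
have := @sz_cat A eA s1 (x :: s2); rewrite sz_cons.
by have := @sz_gt0 _ (@code_seq A eA) s1; lia.
Qed.

Lemma size_le_sz A {eA : Encodable A} (s : seq A) : size s < sz s.
Proof. by elim: s => //= x s IH; rewrite sz_cons; have := @sz_gt0 A eA x; lia. Qed.

(** This is where the bound on output sizes in [polytime] matters: the time of [G] is measured in
    the size of [f x]. *)
Lemma polytime_comp A B C {eA : Encodable A} {eB : Encodable B} {eC : Encodable C}
    (g : B -> C) (f : A -> B) :
  polytime g -> polytime f -> polytime (fun x => g (f x)).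
Proof.
move=> [G [q [pq HG]]] [F [p [pp HF]]].
exists (seqp F G), (fun n => p n + q (p n)); split=> [|x]; first by pbound_tac.
have [szf runf] := HF x; have [szg rung] := HG (f x).
have le_q := leq_pbound pq szf.
split=> [|i m a]; first by apply: leq_trans szg (leq_trans le_q (leq_addl _ _)).
exact: exec_le (exec_seq (runf _ _ _) (rung _ _ _)) (leq_add (leqnn _) le_q).
Qed.

Definition skipp : prog Sigma :=
  stepp (fun=> Five None None None None None).

Lemma exec_skip S : exec skipp S 1 S.
Proof. by have := exec_step (fun=> Five None None None None None) S; case: S. Qed.

Lemma polytime_id A {eA : Encodable A} : polytime (fun x : A => x).
Proof.
exists skipp, (fun n => 1 + n); split=> [|x]; first by pbound_tac.
by split=> [|i m a]; [lia | apply: exec_le (exec_skip _) _].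
Qed.

Definition wordp (w : seq letter) : prog Sigma :=
  foldr (fun x F => seqp F (pushp x)) skipp w.

Lemma exec_word w i m a s c :
  exec (wordp w) (Five i m a s c) (size w).+1 (Five i (w ++ m) a s c).
Proof.
elim: w => [|x w IH]; first exact: exec_skip.
by rewrite /= -addn1; apply: exec_seq IH (exec_push _ _ _ _ _ _).
Qed.

Lemma polytime_const A B {eA : Encodable A} {eB : Encodable B} (b : B) :
  polytime (fun _ : A => b).
Proof.
exists (seqp (movep Sigma false false false) (wordp (flat (code b)))).
exists (fun n => 2 * n + (2 + sz b)); split=> [|x]; first by pbound_tac.
split=> [|i m a]; first by lia.
apply: exec_le (exec_seq (exec_drop _ _ _ _) (exec_word _ _ _ _ _ _)) _.
by rewrite /sz; lia.
Qed.

(** A copy of the argument waits on [aux] while [g] is computed; then it is put on top of the result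
    and replaced by the value of [f]. A single [node] completes the pair. *)
Lemma polytime_pair A B C {eA : Encodable A} {eB : Encodable B} {eC : Encodable C}
    (f : A -> B) (g : A -> C) :
  polytime f -> polytime g -> polytime (fun x => (f x, g x)).
Proof.
move=> [F [p [pp HF]]] [G [q [pq HG]]].
exists (seqp (movep Sigma false true true) (seqp G
  (seqp (movep Sigma true true false) (seqp F (pushp node))))).
exists (fun n => p n + q n + 4 * n + 3); split=> [|x]; first by pbound_tac.
have [szf runf] := HF x; have [szg rung] := HG x.
split=> [|i m a]; first by rewrite sz_pair; lia.
apply: exec_le (exec_seq (exec_copy _ _ _ _) (exec_seq (rung _ _ _)
  (exec_seq (exec_restore _ _ _ _) (exec_seq (runf _ _ _)
  (_ : exec _ _ 1 _))))) _; last by rewrite -/(sz x); lia.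
by rewrite flat_pair; apply: exec_push.
Qed.

Lemma polytime_fst0 A B {eA : Encodable A} {eB : Encodable B} :
  polytime (fun x : A * B => x.1).
Proof.
exists (seqp (popp Sigma) (seqp (movep Sigma false false true)
  (seqp (movep Sigma false false false) (movep Sigma true true false)))).
exists (fun n => 6 * n + 4); split=> [|[x y]]; first by pbound_tac.
split=> [|i m a]; first by rewrite sz_pair /=; lia.
rewrite flat_pair; apply: exec_le (exec_seq (exec_pop _ _ _ _ _ _) _) _.
  apply: exec_seq (exec_save _ _ _ _)
   (exec_seq (exec_drop _ _ _ _) (exec_restore _ _ _ _)).
by rewrite -!/(sz _) sz_pair; lia.
Qed.

Lemma polytime_snd0 A B {eA : Encodable A} {eB : Encodable B} :
  polytime (fun x : A * B => x.2).
Proof.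
exists (seqp (popp Sigma) (movep Sigma false false false)).
exists (fun n => 6 * n + 4); split=> [|[x y]]; first by pbound_tac.
split=> [|i m a]; first by rewrite sz_pair /=; lia.
rewrite flat_pair; apply: exec_le (exec_seq (exec_pop _ _ _ _ _ _) _) _.
  exact: exec_drop.
by rewrite -!/(sz _) sz_pair; lia.
Qed.

Lemma polytime_fst A B C {eA : Encodable A} {eB : Encodable B} {eC : Encodable C}
  (f : A -> B * C) : polytime f -> polytime (fun x => (f x).1).
Proof. exact/polytime_comp/polytime_fst0. Qed.

Lemma polytime_snd A B C {eA : Encodable A} {eB : Encodable B} {eC : Encodable C}
  (f : A -> B * C) : polytime f -> polytime (fun x => (f x).2).
Proof. exact/polytime_comp/polytime_snd0. Qed.

(** Once the [node] of the pair [(c x, x)] is popped, one Boolean letter lies on top of the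
    argument, and [ifp] consumes it. *)
Lemma polytime_if A B {eA : Encodable A} {eB : Encodable B} (c : A -> bool)
    (f g : A -> B) :
  polytime c -> polytime f -> polytime g -> polytime (fun x => if c x then f x else g x).
Proof.
move=> pc [F [p [pp HF]]] [G [q [pq HG]]].
have [K [r [pr HK]]] := polytime_pair pc polytime_id.
exists (seqp K (seqp (popp Sigma) (ifp (inr (Some true)) F G))).
exists (fun n => r n + p n + q n + 2); split=> [|x]; first by pbound_tac.
have [szf runf] := HF x; have [szg rung] := HG x; have [szk runk] := HK x.
split=> [|i m a]; first by case: (c x); lia.
apply: exec_le (exec_seq (runk _ _ _) (exec_seq (exec_pop _ _ _ _ _ _) _)) _.
- apply: (@exec_if _ _ _ _ _ _ _ _ _ _ (p (sz x) + q (sz x))).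
  have -> : (leaf (inr (c x)) == inr (Some true) :> letter) = c x.
    by apply/eqP/idP => [[]|->].
  case: (c x).
    by apply: exec_le (runf i m a) _; lia.
  by apply: exec_le (rung i m a) _; lia.
- by lia.
Qed.

Lemma polytime_test A {eA : Encodable A} (f : Sigma -> bool) (g : A -> Sigma) :
  polytime g -> polytime (fun x => f (g x)).
Proof.
apply: polytime_comp.
exists (replacep (fun x => if x is inl a then inr (Some (f a)) else x)).
exists (fun n => n + 1); split=> [|x]; first by pbound_tac.
split=> [|i m a]; first by rewrite sz_bool sz_letter.
by apply: exec_le (exec_replace _ _ _ _ _ _ _) _; rewrite sz_letter.
Qed.

Lemma polytime_cons A X {eA : Encodable A} {eX : Encodable X} (f : A -> X)
    (g : A -> seq X) :
  polytime f -> polytime g -> polytime (fun x => f x :: g x).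
Proof. exact: polytime_pair. Qed.

(** After its first letters are consumed, the code of [(y :: s, x)] reads [y], [s], [x]. Turning it
    into [(y, (s, x))] takes one [node] below [y], whence the detour of [y] through [aux], and one
    above. *)
Lemma polytime_case A B X {eA : Encodable A} {eB : Encodable B} {eX : Encodable X}
    (l : A -> seq X) (f : A -> X -> seq X -> B) (g : A -> B) :
  polytime l -> polytime (fun q : X * (seq X * A) => f q.2.2 q.1 q.2.1) -> polytime g ->
  polytime (fun x => if l x is y :: s then f x y s else g x).
Proof.
move=> pl [F [p [pp HF]]] [G [q [pq HG]]].
have [K [r [pr HK]]] := polytime_pair pl polytime_id.
exists (seqp K (seqp (popp Sigma) (ifp node
  (seqp (movep Sigma false false true) (seqp (pushp node)
    (seqp (movep Sigma true true false) (seqp (pushp node) F)))) G))).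
exists (fun n => r n + p (1 + r n) + q n + 4 * r n + 6).
split=> [|x]; first by pbound_tac.
have [szg rung] := HG x; have [szk runk] := HK x.
have szk' := szk; rewrite sz_pair in szk'.
case El: (l x) => [|y s].
  split=> [|i m a]; first by lia.
  rewrite El in runk.
  apply: exec_le (exec_seq (runk _ _ _) (exec_seq (exec_pop _ _ _ _ _ _) _)) _;
    first by apply: (exec_if (k := q (sz x))); apply: rung.
  by lia.
have [szf runf] := HF (y, (s, x)); rewrite El in runk szk'.
rewrite sz_cons in szk'.
have le_p : p (sz (y, (s, x))) <= p (1 + r (sz x)).
  by apply: leq_pbound => //; rewrite !sz_pair; lia.
split=> [|i m a]; first by apply: leq_trans szf _; lia.
have {}runk := runk i m a; rewrite flat_pair flat_cons in runk.
apply: exec_le (exec_seq runk (exec_seq (exec_pop _ _ _ _ _ _) _)) _.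
  apply: exec_if; rewrite eqxx.
  apply: exec_seq (exec_save _ _ _ _) (exec_seq (exec_push _ _ _ _ _ _)
    (exec_seq (exec_restore _ _ _ _) (exec_seq (exec_push _ _ _ _ _ _) _))).
  by have := runf i m a; rewrite !flat_pair; apply.
by rewrite -!/(sz _); lia.
Qed.

(* During the loop [main] holds the pair of the accumulator and the parameter
   [e], and [aux] the rest of the list. *)
Lemma polytime_foldl A E X {eA : Encodable A} {eE : Encodable E} {eX : Encodable X}
    (f : E -> A -> X -> A) (z : E -> A) (l : E -> seq X) (b : nat -> nat) :
  pbound b ->
  (forall e s1 s2, l e = s1 ++ s2 -> sz (foldl (f e) (z e) s1) <= b (sz e)) ->
  polytime (fun q : X * (A * E) => f q.2.2 q.2.1 q.1) -> polytime z -> polytime l ->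
  polytime (fun e => foldl (f e) (z e) (l e)).
Proof.
move=> pb Hb pf pz pl.
(* One round maps [(x, (a, e))] to [(f e a x, e)], so the parameter survives for the next round. *)
have [F [p [pp HF]]] := polytime_pair pf (polytime_snd (polytime_snd polytime_id)).
have [K [r [pr HK]]] := polytime_pair pl (polytime_pair pz polytime_id).
have [H [t [pt HH]]] := @polytime_fst0 A E eA eE.
exists (seqp K (seqp (popp Sigma) (seqp (movep Sigma false false true) (seqp
  (whilep node (seqp (movep Sigma true true false) (seqp (pushp node) F))) H)))).
(* [T n] bounds one round: the loop test, moving an element of size at most [r n] back to [main],
   pushing [node], and running [F]. *)
pose T n := 2 * r n + 3 + p (2 + r n + b n + n).
exists (fun n => r n + 2 * r n + r n * T n + t (b n + n + 1) + 10 + b n).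
split=> [|e]; first by rewrite /T; pbound_tac.
have [szk runk] := HK e; have szk' := szk; rewrite !sz_pair in szk'.
split=> [|i m a].
  by have := Hb e (l e) [::]; rewrite cats0 => /(_ erefl); lia.
have loop s2 s1 : l e = s1 ++ s2 ->
    exec (whilep node (seqp (movep Sigma true true false) (seqp (pushp node) F)))
      (Five i (flat (code (foldl (f e) (z e) s1, e)) ++ m)
              (flat (code s2) ++ a) [::] [::])
      (size s2 * T (sz e) + 1)
      (Five i (flat (code (foldl (f e) (z e) (l e), e)) ++ m) a [::] [::]).
  elim: s2 s1 => [|x s2 IH] s1 El; last rewrite flat_cons.
    by rewrite El cats0; apply: exec_while_stop.
  have El' : l e = rcons s1 x ++ s2 by rewrite cat_rcons.
  have := Hb _ _ _ El; set y := foldl _ _ s1 => szy.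
  have [_ runf] := HF (x, (y, e)).
  apply: exec_le (exec_while_loop _ (IH _ El')) _.
    rewrite -/(flat _) -?catA.
    apply: exec_seq (exec_restore _ _ _ _)
      (exec_seq (exec_push _ _ _ _ _ _) _).
    have := runf i m (flat (code s2) ++ a); rewrite !flat_pair foldl_rcons.
    by apply.
  have szx := @sz_mem X eX s1 s2 x; rewrite -El in szx.
  have : p (sz (x, (y, e))) <= p (2 + r (sz e) + b (sz e) + sz e).
    by apply: leq_pbound => //; rewrite !sz_pair; lia.
  by rewrite -!/(sz _) [size (_ :: _)]/= mulSn /T; lia.
have [_ runh] := HH (foldl (f e) (z e) (l e), e).
have {}runk := runk i m a; rewrite flat_pair in runk.
apply: exec_le (exec_seq runk (exec_seq (exec_pop _ _ _ _ _ _) _)) _.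
  apply: exec_seq (exec_save _ _ _ _) (exec_seq (loop (l e) [::] erefl) (runh _ _ _)).
have : t (sz (foldl (f e) (z e) (l e), e)) <= t (b (sz e) + sz e + 1).
  apply: leq_pbound => //; have := Hb e (l e) [::].
  by rewrite cats0 => /(_ erefl); rewrite sz_pair; lia.
have : size (l e) * T (sz e) <= r (sz e) * T (sz e).
  by apply: leq_mul => //; have := @size_le_sz X eX (l e); lia.
by rewrite -!/(sz _) -/(T _); lia.
Qed.

(* It suffices that each step increases a measure [mu], equivalent to the size up
   to polynomials, by an amount that does not depend on the accumulator. *)
Lemma polytime_foldl_mu A E X {eA : Encodable A} {eE : Encodable E}
    {eX : Encodable X} (mu : A -> nat) (g h : nat -> nat)
    (f : E -> A -> X -> A) (z : E -> A) (l : E -> seq X) :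
  pbound g -> pbound h ->
  (forall e a x, mu (f e a x) <= mu a + g (sz e + sz x)) ->
  (forall a, mu a <= sz a <= h (mu a)) ->
  polytime (fun q : X * (A * E) => f q.2.2 q.2.1 q.1) -> polytime z -> polytime l ->
  polytime (fun e => foldl (f e) (z e) (l e)).
Proof.
move=> pg ph Hg Hmu pf pz pl.
have [Z [p [pp Hz]]] := pz; have [L [q [pq Hl]]] := pl.
apply: (polytime_foldl (b := fun n => h (p n + q n * g (n + q n)))) => //.
  by pbound_tac.
move=> e s1 s2 El; have [szz _] := Hz e; have [szl _] := Hl e.
have [_ /leq_trans->//] := andP (Hmu (foldl (f e) (z e) s1)).
apply: leq_pbound => //.
(* Every element is smaller than the list, whose size is at most [q (sz e)]; hence each round adds
   at most [g (sz e + q (sz e))]. *)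
have: mu (foldl (f e) (z e) s1) <= mu (z e) + size s1 * g (sz e + q (sz e)).
  elim/last_ind: s1 s2 El => [|s1 x IH] s2 El; first by rewrite /= leq_addr.
  rewrite foldl_rcons size_rcons mulSn.
  have := IH (x :: s2); rewrite -cat_rcons => /(_ El) {}IH.
  have := Hg e (foldl (f e) (z e) s1) x.
  have: g (sz e + sz x) <= g (sz e + q (sz e)).
    apply: leq_pbound => //; have := @sz_mem X eX s1 s2 x.
    by rewrite -cat_rcons -El; lia.
  by lia.
have: size s1 * g (sz e + q (sz e)) <= q (sz e) * g (sz e + q (sz e)).
  apply: leq_mul => //; have := @size_le_sz X eX (l e).
  by rewrite El size_cat; rewrite El in szl; lia.
by have /andP[] := Hmu (z e); lia.
Qed.

Lemma polytime_foldl_grow A E X {eA : Encodable A} {eE : Encodable E}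
    {eX : Encodable X} (g : nat -> nat)
    (f : E -> A -> X -> A) (z : E -> A) (l : E -> seq X) :
  pbound g ->
  (forall e a x, sz (f e a x) <= sz a + g (sz e + sz x)) ->
  polytime (fun q : X * (A * E) => f q.2.2 q.2.1 q.1) -> polytime z -> polytime l ->
  polytime (fun e => foldl (f e) (z e) (l e)).
Proof.
move=> pg Hg; apply: (polytime_foldl_mu pg pbound_id Hg) => a.
by rewrite leqnn.
Qed.

Lemma polytime_eq A B {eA : Encodable A} {eB : Encodable B} (f g : A -> B) :
  f =1 g -> polytime f -> polytime g.
Proof.
by move=> eq_fg [F [p [pp HF]]]; exists F, p; split=> // x; rewrite -eq_fg.
Qed.

Lemma foldl_catrev X (s u : seq X) : foldl (fun s x => x :: s) u s = catrev s u.
Proof. by elim: s u => /=. Qed.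

Lemma polytime_rev A X {eA : Encodable A} {eX : Encodable X} (f : A -> seq X) :
  polytime f -> polytime (fun x => rev (f x)).
Proof.
move=> pf; apply: (@polytime_eq _ _ _ _ (fun x => foldl (fun s x => x :: s) [::] (f x))).
  by move=> x; rewrite foldl_catrev.
apply: (polytime_foldl_grow (g := fun n => n + 1) (f := fun _ s x => x :: s)
  (z := fun=> [::])) => //.
- by pbound_tac.
- by move=> e a x; rewrite sz_cons; lia.
- exact: polytime_pair polytime_fst0 (polytime_fst polytime_snd0).
- exact: polytime_const.
Qed.

(** Pushing a letter and then [node] on top of the code of a list conses the letter onto it, so an
    input letter takes two steps. *)
Definition readp : prog Sigma :=
  @Prog Sigma bool false (fun q r =>
    if q then (Some false, Five None (Some (Some node)) None None None)
    else if inp r is Some x then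
      (Some true, Five (Some None) (Some (Some x)) None None None)
    else (None, Five None None None None None)).

Lemma run_read w u :
  @run _ readp (Some false)
    (Five (map inl w) (flat (code u)) [::] [::] [::]) (2 * size w).+1
    (Five [::] (flat (code (catrev w u))) [::] [::] [::]).
Proof.
elim: w u => [|a w IH] u; first by apply: run_step; apply: run_exit.
rewrite mulnS; apply: run_step => /=; apply: run_step => /=; exact: (IH (a :: u)).
Qed.

(* The input is popped into a tree, which therefore holds the reversed word. *)
Lemma polytime_in_P (d : seq Sigma -> bool) : polytime d -> in_P (fun w => d w : Prop).
Proof.
move=> pd; have [F [p [pp HF]]] := polytime_comp pd (polytime_rev polytime_id).
pose T n := 2 * n + 2 + p (2 * n + 1).
have [|w|M [c [k H]]] :=
  @exec_decides _ (seqp (pushp (inr (Some false))) (seqp readp F)) d T.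
- by rewrite /T; pbound_tac.
- exists (Five [::] [:: inr (Some (d w))] [::] [::] [::]) => //.
  have [_ runF] := HF (rev w); have {runF} := runF [::] [::] [::].
  rewrite revK !cats0 => runF.
  have szw : sz (rev w) = 2 * size w + 1.
    rewrite -(size_rev w); elim: (rev w) => // a v IH.
    by rewrite sz_cons IH sz_letter /=; lia.
  have runR : exec readp (Five (map inl w) [:: inr (Some false)] [::] [::] [::])
      (2 * size w).+1 (Five [::] (flat (code (rev w))) [::] [::] [::]).
    by exists (2 * size w).+1 => //; apply: (run_read w [::]).
  apply: exec_le (exec_seq (exec_push _ _ _ _ _ _) (exec_seq runR runF)) _.
  by rewrite /T szw; lia.
by exists M, c, k => w; exists (d w).
Qed.

End Poly.

#[export] Hint Extern 1 (polytime (fun e => e)) => apply: polytime_id : poly.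
#[export] Hint Extern 1 (polytime (fun e => ?c)) => apply: polytime_const : poly.
#[export] Hint Extern 1 (polytime (@fst _ _)) => apply: polytime_fst0 : poly.
#[export] Hint Extern 1 (polytime (@snd _ _)) => apply: polytime_snd0 : poly.
#[export] Hint Extern 2 (polytime (fun e => (@?f e, @?g e))) =>
  apply: (polytime_pair (f := f) (g := g)) : poly.
#[export] Hint Extern 2 (polytime (fun e => fst (@?f e))) =>
  apply: (polytime_fst (f := f)) : poly.
#[export] Hint Extern 2 (polytime (fun e => snd (@?f e))) =>
  apply: (polytime_snd (f := f)) : poly.
#[export] Hint Extern 2 (polytime (fun e => @?f e :: @?g e)) =>
  apply: (polytime_cons (f := f) (g := g)) : poly.
#[export] Hint Extern 2 (polytime (fun e => rev (@?f e))) =>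
  apply: (polytime_rev (f := f)) : poly.
#[export] Hint Extern 3 (polytime _) => simple apply @polytime_if : poly.

Ltac polytime_tac := auto 100 with poly nocore.

(** * Lists and binary arithmetic in polynomial time *)

(** In contrast to [binary], zero has no digits here, so the canonical words are exactly those that
    do not end in a zero. *)
Definition bits (n : nat) : seq bool :=
  if n == 0 then [::] else mkseq (fun k => odd (n %/ 2 ^ k)) (trunc_log 2 n).+1.

Definition bits_val : seq bool -> nat :=
  foldr (fun (b : bool) (n : nat) => b + n.*2) 0.

Lemma bitsE n : bits n = if n == 0 then [::] else odd n :: bits n./2.
Proof.
rewrite {1}/bits; case: eqP => // /eqP n_neq0.
rewrite /mkseq /= expn0 divn1; congr cons; rewrite /bits.
have [->|n_gt1] : n = 1 \/ 1 < n by lia.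
  by [].
have -> : (n./2 == 0) = false by lia.
rewrite trunc_log2S // (iotaDl 1 0) -map_comp; apply: eq_map => k /=.
by rewrite -divn2 -divnMA -expnS.
Qed.

Lemma bitsK : cancel bits bits_val.
Proof.
elim/ltn_ind => n IH; rewrite bitsE; case: eqP => [->//|/eqP n_neq0] /=.
by rewrite IH ?odd_double_half //; lia.
Qed.

Definition trim : seq bool -> seq bool :=
  foldr (fun b s => if s is _ :: _ then b :: s else if b then [:: b] else [::])
    [::].


Lemma bits_nil n : (bits n == [::]) = (n == 0).
Proof. by rewrite bitsE; case: (n =P 0). Qed.

Lemma bits_valK s : bits (bits_val s) = trim s.
Proof.
elim: s => //= b s <-; rewrite bitsE half_bit_double oddD odd_double addbF oddb.
case: (bits _) (bits_nil (bits_val s)) => [/esym/eqP->|x t /esym/negbT v0].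
  by case: b.
by have -> : (b + (bits_val s).*2 == 0) = false by lia.
Qed.

Lemma size_bits_le n k : n < 2 ^ k -> size (bits n) <= k.
Proof.
elim: k n => [|k IH] n; first by rewrite expn0 ltnS leqn0 => /eqP->.
rewrite bitsE expnS => lt_n; case: eqP => // _; rewrite /= ltnS IH //; lia.
Qed.

Lemma ltn_bits n : n < 2 ^ size (bits n).
Proof.
elim/ltn_ind: n => n IH; rewrite bitsE; case: eqP => [->//|/eqP n_neq0] /=.
rewrite expnS; have := IH n./2; lia.
Qed.

Lemma bits_val_cat s t : bits_val (s ++ t) = bits_val s + 2 ^ size s * bits_val t.
Proof. by elim: s => /= [|b s ->]; rewrite ?expnS; lia. Qed.

Definition pad_step (q : seq bool * (seq bool * seq (bool * bool))) :=
  (behead q.1, (behead q.2.1, (head false q.1, head false q.2.1) :: q.2.2)).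

(** The list [s ++ t] only serves as a clock: it is long enough for both words to be exhausted, the
    shorter one being filled up with zeros. *)
Definition pad (s t : seq bool) : seq (bool * bool) :=
  rev (foldl (fun q _ => pad_step q) (s, (t, [::])) (s ++ t)).2.2.

Lemma padP s t : bits_val (map fst (pad s t)) = bits_val s /\
  bits_val (map snd (pad s t)) = bits_val t.
Proof.
rewrite /pad.
have: size s <= size (s ++ t) by rewrite size_cat leq_addr.
have: size t <= size (s ++ t) by rewrite size_cat leq_addl.
have: forall u (s t : seq bool) r, size t <= size u -> size s <= size u ->
  exists ps, [/\ (foldl (fun q _ => pad_step q) (s, (t, r)) u).2.2 = catrev ps r,
    bits_val (map fst ps) = bits_val s & bits_val (map snd ps) = bits_val t].
  move=> {s t} X; elim=> [|x u IH] s t r /=.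
    by case: s => //; case: t => //; exists [::].
  move=> le_t le_s; have [||ps [-> E1 E2]] :=
    IH (behead s) (behead t) ((head false s, head false t) :: r).
  - by rewrite size_behead; lia.
  - by rewrite size_behead; lia.
  exists ((head false s, head false t) :: ps); split=> //=.
    by rewrite E1; case: (s).
  by rewrite E2; case: (t).
move=> H le1 le2; have [ps [-> <- <-]] := H _ _ _ _ [::] le1 le2.
by rewrite revK.
Qed.

(** One column of a written addition: [q.1] is the carry, and [q.2] holds the digits found so far,
    latest first. *)
Definition add_step (q : bool * seq bool) (p : bool * bool) :=
  (if q.1 then p.1 || p.2 else p.1 && p.2, (q.1 (+) (p.1 (+) p.2)) :: q.2).

Definition add_bits (s t : seq bool) : seq bool :=
  let q := foldl add_step (false, [::]) (pad s t) in rev (q.1 :: q.2).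

Lemma add_bitsP s t : bits_val (add_bits s t) = bits_val s + bits_val t.
Proof.
have [<- <-] := padP s t; rewrite /add_bits; move: (pad s t) => ps.
pose g (q : bool * seq bool) := bits_val (rev (q.1 :: q.2)).
(* Invariant: the digits in [r] are final, and the carry [c] has weight [2 ^ size r]. *)
suff: forall c r, g (foldl add_step (c, r) ps) =
    bits_val (rev r) + 2 ^ size r * (c + bits_val (map fst ps) + bits_val (map snd ps)).
  by move/(_ false [::]); rewrite mul1n.
elim: ps => [|[x y] ps IH] c r.
  by rewrite /g /= rev_cons -cats1 bits_val_cat size_rev /= !addn0.
rewrite [foldl _ _ _]/= /add_step IH /= rev_cons -cats1 bits_val_cat size_rev expnS /=.
by case: c; case: x; case: y; rewrite /=; lia.
Qed.

(** Going up from the least significant digits, the last pair of distinct digits decides; the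
    initial [true] settles equality. *)
Definition le_bits (s t : seq bool) : bool :=
  foldl (fun c p => if p.1 then (if p.2 then c else false)
                    else (if p.2 then true else c)) true (pad s t).

Lemma le_bitsP s t : le_bits s t = (bits_val s <= bits_val t).
Proof.
have [<- <-] := padP s t; rewrite /le_bits; move: (pad s t) => ps.
set f := (fun c p => _).
suff: forall c, foldl f c ps = (bits_val (map fst ps) < bits_val (map snd ps)) ||
    (bits_val (map fst ps) == bits_val (map snd ps)) && c.
  by move=> ->; rewrite andbT orbC -leq_eqVlt.
elim: ps => [|[x y] ps IH] c //=; rewrite IH.
by case: x; case: y; case: c; rewrite /f /=; lia.
Qed.

(** Horner's scheme from the most significant digit, which reduces a product to additions. *)
Definition mul_bits (a : nat) (s : seq bool) : nat :=
  foldl (fun c (b : bool) => c + c + (if b then a else 0)) 0 (rev s).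

Lemma mul_bitsP a s : mul_bits a s = a * bits_val s.
Proof.
rewrite /mul_bits foldl_rev; elim: s => [|b s IH] /=; first by rewrite muln0.
by rewrite IH; case: b; lia.
Qed.

(** * Polynomial-time programs for list operations and arithmetic *)

Section PolyArithmetic.

Variable Sigma : finType.
Notation Encodable := (Encodable Sigma).
Implicit Types A B C E X : Type.

#[export] Instance code_nat : Encodable nat := fun n => code (bits n).

Lemma sz_bits (s : seq bool) : sz (Sigma := Sigma) s = (size s).*2.+1.
Proof. by elim: s => // b s IH; rewrite sz_cons IH sz_bool. Qed.

Lemma sz_nat (n : nat) : sz (Sigma := Sigma) n = (size (bits n)).*2.+1.
Proof. exact: sz_bits. Qed.

Lemma polytime_andb A {eA : Encodable A} (f g : A -> bool) :
  polytime f -> polytime g -> polytime (fun x => f x && g x).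
Proof. by move=> pf pg; apply: polytime_if pf pg _; apply: polytime_const. Qed.

Lemma polytime_orb A {eA : Encodable A} (f g : A -> bool) :
  polytime f -> polytime g -> polytime (fun x => f x || g x).
Proof. by move=> pf pg; apply: polytime_if pf _ pg; apply: polytime_const. Qed.

Lemma polytime_negb A {eA : Encodable A} (f : A -> bool) :
  polytime f -> polytime (fun x => ~~ f x).
Proof. by move=> pf; apply: polytime_if pf _ _; apply: polytime_const. Qed.

Lemma polytime_addb A {eA : Encodable A} (f g : A -> bool) :
  polytime f -> polytime g -> polytime (fun x => f x (+) g x).
Proof.
move=> pf pg; apply: (@polytime_eq _ _ _ _ _ (fun x => if f x then ~~ g x else g x)).
  by move=> x; case: (f x).
exact: polytime_if pf (polytime_negb pg) pg.
Qed.

Lemma polytime_behead A X {eA : Encodable A} {eX : Encodable X} (f : A -> seq X) :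
  polytime f -> polytime (fun x => behead (f x)).
Proof.
move=> pf; apply: (@polytime_eq _ _ _ _ _ (fun x => if f x is y :: s then s else [::])).
  by move=> x; case: (f x).
apply: polytime_case pf _ _; polytime_tac.
Qed.

Lemma polytime_head A X {eA : Encodable A} {eX : Encodable X} (x0 : X) (f : A -> seq X) :
  polytime f -> polytime (fun x => head x0 (f x)).
Proof.
move=> pf; apply: (@polytime_eq _ _ _ _ _ (fun x => if f x is y :: s then y else x0)).
  by move=> x; case: (f x).
apply: polytime_case pf _ _; polytime_tac.
Qed.

Lemma polytime_cat A X {eA : Encodable A} {eX : Encodable X} (f g : A -> seq X) :
  polytime f -> polytime g -> polytime (fun x => f x ++ g x).
Proof.
move=> pf pg; apply: (@polytime_eq _ _ _ _ _
  (fun x => foldl (fun s y => y :: s) (g x) (rev (f x)))).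
  by move=> x; rewrite foldl_catrev catrevE revK.
apply: (polytime_foldl_grow (g := fun n => n + 1) (f := fun _ s x => x :: s)) => //.
- by pbound_tac.
- by move=> e a x; rewrite sz_cons; lia.
- polytime_tac.
- exact: polytime_rev.
Qed.

Lemma polytime_map A X Y {eA : Encodable A} {eX : Encodable X} {eY : Encodable Y}
    (f : A -> X -> Y) (l : A -> seq X) :
  polytime (fun q : X * A => f q.2 q.1) -> polytime l ->
  polytime (fun x => map (f x) (l x)).
Proof.
move=> pf pl; have [F [p [pp HF]]] := pf.
apply: (@polytime_eq _ _ _ _ _ (fun x => rev (foldl (fun s y => f x y :: s) [::] (l x)))).
  move=> x.
  have H : forall s r, foldl (fun s y => f x y :: s) r s = catrev (map (f x) s) r.
    by elim=> //= y s IH r; rewrite IH.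
  by rewrite H; apply: revK.
apply: polytime_rev.
apply: (polytime_foldl_grow (g := fun n => p (n + 1) + 1)
  (f := fun e s x => f e x :: s)) => //.
- by pbound_tac.
- move=> e a x; rewrite sz_cons; have [szf _] := HF (x, e).
  have : p (sz (x, e)) <= p (sz e + sz x + 1).
    by apply: leq_pbound => //; rewrite sz_pair; lia.
  by move: szf => /=; lia.
- apply: polytime_cons; last by polytime_tac.
  by apply: (polytime_comp (g := fun q => f q.2 q.1)
    (f := fun q => (q.1, q.2.2))); polytime_tac.
- polytime_tac.
Qed.

Lemma polytime_all A X {eA : Encodable A} {eX : Encodable X}
    (f : A -> X -> bool) (l : A -> seq X) :
  polytime (fun q : X * A => f q.2 q.1) -> polytime l ->
  polytime (fun x => all (f x) (l x)).
Proof.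
move=> pf pl.
apply: (@polytime_eq _ _ _ _ _ (fun x => foldl (fun b y => b && f x y) true (l x))).
  have H x : forall s b, foldl (fun b y => b && f x y) b s = b && all (f x) s.
    by elim=> [|y s IH] b /=; rewrite ?andbT // IH andbA.
  by move=> x; rewrite H.
apply: (polytime_foldl_grow (g := fun n => 1) (f := fun e b x => b && f e x)) => //.
- by pbound_tac.
- apply: polytime_andb; first by polytime_tac.
  by apply: (polytime_comp (g := fun q => f q.2 q.1)
    (f := fun q => (q.1, q.2.2))); polytime_tac.
- polytime_tac.
Qed.

(** A number and the list of its bits have the same code. *)
Lemma polytime_bits A {eA : Encodable A} (f : A -> nat) :
  polytime f -> polytime (fun x => bits (f x)).
Proof. by []. Qed.

Lemma polytime_nat A {eA : Encodable A} (f : A -> nat) :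
  polytime (fun x => bits (f x)) -> polytime f.
Proof. by []. Qed.

(** The code of [bits_val s] consists of canonical digits, so all that has to be computed is
    [trim s]. *)
Lemma polytime_bits_val A {eA : Encodable A} (f : A -> seq bool) :
  polytime f -> polytime (fun x => bits_val (f x)).
Proof.
move=> pf; apply: polytime_nat.
apply: (@polytime_eq _ _ _ _ _ (fun x => foldl (fun s b =>
   if s is _ :: _ then b :: s else if b then [:: b] else [::]) [::] (rev (f x)))).
  by move=> x; rewrite bits_valK foldl_rev.
apply: (polytime_foldl_grow (g := fun n => 3) (f := fun _ s b =>
  if s is _ :: _ then b :: s else if b then [:: b] else [::])) => //.
- by pbound_tac.
- by move=> _ [|a s] b; rewrite ?sz_cons ?sz_bool; [case: b | lia].
- apply: polytime_case; first by polytime_tac.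
    by polytime_tac.
  by polytime_tac.
- polytime_tac.
- exact: polytime_rev.
Qed.

Lemma polytime_pad A {eA : Encodable A} (f g : A -> seq bool) :
  polytime f -> polytime g -> polytime (fun x => pad (f x) (g x)).
Proof.
move=> pf pg; apply/polytime_rev/polytime_snd/polytime_snd.
apply: (polytime_foldl_grow (g := fun n => 4) (f := fun _ q _ => pad_step q)).
- by pbound_tac.
- move=> _ [s [t r]] _; rewrite /pad_step !sz_pair sz_cons !sz_pair !sz_bool /=.
  by case: s => [|a s]; case: t => [|b t]; rewrite ?sz_cons ?sz_bool ?sz_nil /=; lia.
- rewrite /pad_step; apply: polytime_pair; first by apply: polytime_behead; polytime_tac.
  apply: polytime_pair; first by apply: polytime_behead; polytime_tac.
  apply: polytime_cons; last by polytime_tac.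
  by apply: polytime_pair; apply: polytime_head; polytime_tac.
- by apply: polytime_pair => //; apply: polytime_pair => //; polytime_tac.
- exact: polytime_cat.
Qed.

Lemma polytime_addn A {eA : Encodable A} (f g : A -> nat) :
  polytime f -> polytime g -> polytime (fun x => f x + g x).
Proof.
move=> pf pg; apply: (@polytime_eq _ _ _ _ _
  (fun x => bits_val (add_bits (bits (f x)) (bits (g x))))).
  by move=> x; rewrite add_bitsP !bitsK.
apply: polytime_bits_val; apply: polytime_rev.
have pq : polytime (fun x =>
    foldl add_step (false, [::]) (pad (bits (f x)) (bits (g x)))).
  apply: (polytime_foldl_grow (g := fun n => 2) (f := fun _ => add_step)).
  - by pbound_tac.
  - by move=> _ [c s] [x y]; rewrite /add_step /= !sz_pair sz_cons !sz_bool; lia.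
  - rewrite /add_step; apply: polytime_pair.
      apply: polytime_if; first by polytime_tac.
        by apply: polytime_orb; polytime_tac.
      by apply: polytime_andb; polytime_tac.
    by apply: polytime_cons; [do 2?apply: polytime_addb; polytime_tac | polytime_tac].
  - polytime_tac.
  - exact: polytime_pad.
exact: polytime_cons (polytime_fst pq) (polytime_snd pq).
Qed.

Lemma polytime_leq A {eA : Encodable A} (f g : A -> nat) :
  polytime f -> polytime g -> polytime (fun x => f x <= g x).
Proof.
move=> pf pg; apply: (@polytime_eq _ _ _ _ _
  (fun x => le_bits (bits (f x)) (bits (g x)))).
  by move=> x; rewrite le_bitsP !bitsK.
apply: (polytime_foldl_grow (g := fun n => 0)
  (f := fun _ (c : bool) (p : bool * bool) => if p.1 then (if p.2 then c else false)
                    else (if p.2 then true else c))) => //.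
- by pbound_tac.
- polytime_tac.
- polytime_tac.
- exact: polytime_pad.
Qed.

Lemma size_bitsD m n : size (bits (m + n)) <= (maxn (size (bits m)) (size (bits n))).+1.
Proof.
apply: size_bits_le; rewrite expnS mul2n -addnn -addSn leq_add //.
  by rewrite (leq_trans (ltn_bits m)) // leq_pexp2l // leq_maxl.
by rewrite ltnW // (leq_trans (ltn_bits n)) // leq_pexp2l // leq_maxr.
Qed.

Lemma size_bitsM m n : size (bits (m * n)) <= size (bits m) + size (bits n).
Proof.
case: (posnP (m * n)) => [->//|]; rewrite muln_gt0 => /andP[m0 n0].
by apply: size_bits_le; rewrite expnD ltn_mul ?ltn_bits.
Qed.

Lemma polytime_muln A {eA : Encodable A} (f g : A -> nat) :
  polytime f -> polytime g -> polytime (fun x => f x * g x).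
Proof.
move=> pf pg; have [F [p [pp HF]]] := pf.
apply: (@polytime_eq _ _ _ _ _ (fun x => mul_bits (f x) (bits (g x)))).
  by move=> x; rewrite mul_bitsP bitsK.
(* The doubling and the addition yield at most one bit each beyond the longer operand, and a bit
   takes two letters, whence 4; [p n] accounts for the size of [f e]. *)
apply: (polytime_foldl_grow (g := fun n => 4 + p n)
  (f := fun e c (b : bool) => c + c + (if b then f e else 0))).
- by pbound_tac.
- move=> e c b; have [szf _] := HF e.
  have le_p : p (sz e) <= p (sz e + sz (Sigma := Sigma) b).
    exact: (leq_pbound pp (leq_addr _ _)).
  move: szf; rewrite !sz_nat => szf.
  have := size_bitsD (c + c) (if b then f e else 0); have := size_bitsD c c.
  have : size (bits 0) = 0 by [].
  by rewrite maxnn; case: b le_p => /=; lia.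
- apply: polytime_addn; first by apply: polytime_addn; polytime_tac.
  apply: polytime_if; [by polytime_tac | | by polytime_tac].
  by apply: (polytime_comp pf); polytime_tac.
- exact: polytime_const.
- exact/polytime_rev/polytime_bits.
Qed.

Lemma polytime_size A X {eA : Encodable A} {eX : Encodable X} (f : A -> seq X) :
  polytime f -> polytime (fun x => size (f x)).
Proof.
move=> pf; apply: (@polytime_eq _ _ _ _ _ (fun x => foldl (fun n _ => n + 1) 0 (f x))).
  move=> x; have H : forall s n, foldl (fun n (_ : X) => n + 1) n s = n + size s.
    by elim=> [|y s IH] n /=; rewrite ?addn0 // IH addnAC addn1 addnS.
  by rewrite H.
apply: (polytime_foldl_grow (g := fun n => 4) (f := fun _ n _ => n + 1)) => //.
- by pbound_tac.
- move=> e n x; rewrite !sz_nat; have := size_bitsD n 1.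
  have : size (bits 1) = 1 by []; lia.
- by apply: polytime_addn; polytime_tac.
- exact: polytime_const.
Qed.

Lemma polytime_flatten A X {eA : Encodable A} {eX : Encodable X} (f : A -> seq (seq X)) :
  polytime f -> polytime (fun x => flatten (f x)).
Proof.
move=> pf; apply: (@polytime_eq _ _ _ _ _
  (fun x => foldl (fun s t => t ++ s) [::] (rev (f x)))).
  by move=> x; rewrite foldl_rev.
apply: (polytime_foldl_grow (g := fun n => n) (f := fun _ s t => t ++ s)) => //.
- by pbound_tac.
- by move=> e s t; have := @sz_cat Sigma X eX t s; lia.
- by apply: polytime_cat; polytime_tac.
- exact: polytime_const.
- exact: polytime_rev.
Qed.

(** The fold along the first list carries the unread part of the second one. Unequal lengths show as
    a premature end, which clears the flag, or as a nonempty remainder. *)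
Lemma polytime_all2 A X Y {eA : Encodable A} {eX : Encodable X} {eY : Encodable Y}
    (r : X -> Y -> bool) (f : A -> seq X) (g : A -> seq Y) :
  polytime (fun p : X * Y => r p.1 p.2) -> polytime f -> polytime g ->
  polytime (fun x => all2 r (f x) (g x)).
Proof.
move=> pr pf pg.
pose stp (q : seq Y * bool) x :=
  (behead q.1, q.2 && (if q.1 is y :: _ then r x y else false)).
have pq : polytime (fun x => foldl stp (g x, true) (f x)).
  apply: (polytime_foldl_grow (g := fun=> 0) (f := fun _ => stp)).
  - by pbound_tac.
  - by move=> _ [[|y t] b] x; rewrite !sz_pair ?sz_cons ?sz_nil !sz_bool /=; clear; lia.
  - apply: polytime_pair; first by apply: polytime_behead; polytime_tac.
    apply: polytime_andb; first by polytime_tac.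
    apply: polytime_case; [by polytime_tac | | by polytime_tac].
    by apply: (polytime_comp (g := fun p => r p.1 p.2)
      (f := fun q => (q.2.2.1, q.1))); polytime_tac.
  - by apply: polytime_pair => //; apply: polytime_const.
  - by [].
pose nl (t : seq Y) := if t is _ :: _ then false else true.
apply: (@polytime_eq _ _ _ _ _ (fun x => (foldl stp (g x, true) (f x)).2 &&
   nl (foldl stp (g x, true) (f x)).1)) => [x|].
  have H : forall s t b, (foldl stp (t, b) s).2 && nl (foldl stp (t, b) s).1 =
      b && all2 r s t.
    elim=> [|y s IH] [|z t] b //=; rewrite IH ?andbA //= ?andbF //.
  by rewrite H.
apply: polytime_andb; first exact: polytime_snd.
by apply: polytime_case; [apply: polytime_fst pq | |]; apply: polytime_const.
Qed.

(** Over a finite alphabet, equality is a fixed finite disjunction of tests on single letters. *)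
Lemma polytime_eqletter A {eA : Encodable A} (f g : A -> Sigma) :
  polytime f -> polytime g -> polytime (fun x => f x == g x).
Proof.
move=> pf pg; apply: (@polytime_eq _ _ _ _ _
  (fun x => has (fun a => (f x == a) && (g x == a)) (enum Sigma))) => [x|].
  apply/hasP/eqP => [[a _ /andP[/eqP-> /eqP->]]|eq_fg] //.
  by exists (f x); rewrite ?mem_enum // eq_fg !eqxx.
elim: (enum Sigma) => [|a s IH] /=; first exact: polytime_const.
by apply: polytime_orb IH; apply: polytime_andb; apply: (polytime_test (fun b => b == a)).
Qed.

Lemma sz_rev X {eX : Encodable X} (s : seq X) : sz (rev s) = sz s.
Proof.
elim: s => // x s IH; rewrite rev_cons -cats1.
by have := @sz_cat Sigma X eX (rev s) [:: x]; rewrite !sz_cons sz_nil IH; lia.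
Qed.

End PolyArithmetic.

#[export] Hint Extern 2 (polytime (fun e => andb (@?f e) (@?g e))) =>
  apply: (polytime_andb (f := f) (g := g)) : poly.
#[export] Hint Extern 2 (polytime (fun e => addn (@?f e) (@?g e))) =>
  apply: (polytime_addn (f := f) (g := g)) : poly.
#[export] Hint Extern 2 (polytime (fun e => muln (@?f e) (@?g e))) =>
  apply: (polytime_muln (f := f) (g := g)) : poly.
#[export] Hint Extern 2 (polytime (fun e => leq (@?f e) (@?g e))) =>
  apply: (polytime_leq (f := f) (g := g)) : poly.
#[export] Hint Extern 2 (polytime (fun e => size (@?f e))) =>
  apply: (polytime_size (f := f)) : poly.
#[export] Hint Extern 2 (polytime (fun e => @?f e ++ @?g e)) =>
  apply: (polytime_cat (f := f) (g := g)) : poly.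
#[export] Hint Extern 2 (polytime (fun e => behead (@?f e))) =>
  apply: (polytime_behead (f := f)) : poly.
#[export] Hint Extern 2 (polytime (fun e => head ?x (@?f e))) =>
  apply: (polytime_head x (f := f)) : poly.

Import Order.TTheory GRing.Theory Num.Theory.

(** * Fair allocations between two identical agents *)

Section FairBundles.

Local Open Scope ring_scope.

Variables (R : realFieldType) (m : nat) (v : 'I_m -> R).
Hypothesis v_ge0 : forall g, 0 <= v g.
Implicit Types (A B : {set 'I_m}) (g : 'I_m).

Definition value A : R := \sum_(g in A) v g.

Definition fair A : bool :=
  (~: A == set0) || [exists g, (g \notin A) && (value (~: A :\ g) <= value A)].

(* For [t] the value of the best good outside an optimal bundle of [m - k] goods,
   this says that the bundle is fair. *)
Definition feasible_at (k : nat) (t : R) : bool :=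
  \sum_g v g + k.*2%:R * t <= 2 * (\sum_g Num.max (v g) t) + t.

Lemma sum_setC (F : 'I_m -> R) A :
  \sum_g F g = \sum_(g in A) F g + \sum_(g in ~: A) F g.
Proof.
rewrite (bigID (mem A)) /=; congr (_ + _).
by apply: eq_bigl => g; rewrite inE.
Qed.

Lemma sum_setD1 (F : 'I_m -> R) A g : g \in A ->
  \sum_(h in A) F h = F g + \sum_(h in A :\ g) F h.
Proof. exact: big_setD1. Qed.

(** For the good [g] that witnesses fairness, bound [Num.max (v h) t] below by [v h] on [A], by [t]
    on [~: A :\ g], and by both [v g] and [t] at [h = g]. *)
Lemma fair_feasible A t : 0 <= t -> fair A -> feasible_at #|~: A| t.
Proof.
move=> t_ge0 /orP[/eqP A0|/existsP[g /andP[gA le_g]]]; rewrite /feasible_at.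
  rewrite A0 cards0 mul0r addr0.
  have: \sum_g v g <= \sum_g Num.max (v g) t.
    by apply: ler_sum => g _; rewrite le_max lexx.
  have : 0 <= \sum_g v g by apply: sumr_ge0.
  lra.
have gA' : g \in ~: A by rewrite inE.
have cardA : (#|~: A| = #|~: A :\ g|.+1)%N by rewrite (cardsD1 g) gA' add1n.
rewrite !(sum_setC _ A) !(sum_setD1 _ gA') cardA.
have : \sum_(h in A) v h <= \sum_(h in A) Num.max (v h) t.
  by apply: ler_sum => h _; rewrite le_max lexx.
have : \sum_(h in ~: A :\ g) t <= \sum_(h in ~: A :\ g) Num.max (v h) t.
  by apply: ler_sum => h _; rewrite le_max lexx orbT.
have : v g <= Num.max (v g) t by rewrite le_max lexx.
have : t <= Num.max (v g) t by rewrite le_max lexx orbT.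
move: le_g; rewrite /value sumr_const -mulr_natl doubleS -addn2 -muln2.
rewrite natrD natrM; set c := #|_|%:R; lra.
Qed.

Lemma feasible_fair s k : (s + k = m)%N ->
  (forall g, feasible_at k (v g)) -> exists2 A : {set 'I_m}, #|A| = s & fair A.
Proof.
move=> skm feas; have [k0|k_gt0] := posnP k.
  exists setT; first by rewrite cardsT card_ord -skm k0 addn0.
  by rewrite /fair setCT eqxx.
have [A0 _ /eqP cardA0] : exists2 A : {set 'I_m}, A \subset [set: 'I_m] & #|A| == s.
  have : (s <= #|[set: 'I_m]|)%N by rewrite cardsT card_ord -skm leq_addr.
  by case/card_geqP=> l [ul sl _]; exists [set x in l];
    rewrite ?subsetT // cardsE (card_uniqP ul) sl.
(* A bundle of maximal value among those of size [s] stands in for the [s] best goods. *)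
have [A /eqP cardA maxA] :=
  @arg_maxP _ _ _ A0 (fun A => #|A| == s) value (introT eqP cardA0).
have cardAC : #|~: A| = k by have := cardsC A; rewrite card_ord cardA; lia.
have [g0 g0A] : exists g, g \in ~: A by apply/card_gt0P; rewrite cardAC.
have [g gA maxg] := @arg_maxP _ _ _ g0 (fun g => g \in ~: A) v g0A.
have gA' : g \notin A by rewrite inE in gA.
exists A => //; apply/orP; right; apply/existsP; exists g; rewrite gA' /=.
(* Otherwise exchanging [a] for [g] would increase the value of [A]. *)
have le_gA a : a \in A -> v g <= v a.
  move=> aA; have neq_ga : g != a by apply: contraNneq gA' => ->.
  have := maxA (g |: A :\ a); rewrite cardsU1 !inE (negPf gA') andbF.
  rewrite -cardA (cardsD1 a A) aA eqxx => /(_ isT).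
  rewrite /value (sum_setD1 _ aA) big_setU1 /=; last by rewrite !inE (negPf gA') andbF.
  lra.
(* At [t = v g] the maxima are [v h] on [A] and [v g] outside. The terms in [k] cancel, and what
   remains is fairness witnessed by [g]. *)
have := feas g; rewrite /feasible_at !(sum_setC _ A).
have -> : \sum_(h in A) Num.max (v h) (v g) = \sum_(h in A) v h.
  by apply: eq_bigr => a /le_gA le_ga; apply/max_idPl.
have -> : \sum_(h in ~: A) Num.max (v h) (v g) = \sum_(h in ~: A) v g.
  by apply: eq_bigr => b bA; apply/max_idPr; apply: maxg.
rewrite sumr_const cardAC -mulr_natl -muln2 natrM !(sum_setD1 _ gA) /value.
set c := k%:R; lra.
Qed.

(* Exchanging a good [a] of [A] against a good outside of [A] keeps [A] fair
   as long as [~: A] is not: [A :\ a] alone is worth more than [~: A]. *)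
Lemma fair_exchange A a b : ~~ fair (~: A) -> a \in A -> b \notin A ->
  fair (b |: A :\ a).
Proof.
rewrite /fair setCK negb_or negb_exists => /andP[_ /forallP/(_ a)].
rewrite inE negbK => + aA bA; rewrite aA /= -ltNge => lt_a.
apply/orP; right; apply/existsP; exists a.
have neq_ab : a != b by apply: contraNneq bA => <-.
rewrite !inE (negPf neq_ab) eqxx /=.
have -> : ~: (b |: A :\ a) :\ a = ~: A :\ b.
  apply/setP => x; rewrite !inE; case: (eqVneq x a) => [->|xa] /=.
    by rewrite aA andbF.
  by case: (eqVneq x b) => [->|xb] /=; rewrite ?(negPf bA).
have b' : b \in ~: A by rewrite inE.
move: lt_a; rewrite /value (sum_setD1 _ b') big_setU1; last first.
  by rewrite !inE (negPf bA) andbF.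
have := v_ge0 b; rewrite /=; lra.
Qed.

(** Induction on the size of [A :\: B]. While [~: A] is not fair, trading a good of [A :\: B] for
    one of [B :\: A] keeps [A] fair and brings it closer to [B], whose complement is fair. *)
Lemma fair_meet A B : #|A| = #|B| -> fair A -> fair (~: B) ->
  exists C : {set 'I_m}, [/\ #|C| = #|B|, fair C & fair (~: C)].
Proof.
have [n] := ubnP #|A :\: B|; elim: n A => // n IH A lt_n cardAB fairA fairB.
have [fairAC|nfair] := boolP (fair (~: A)); first by exists A.
have [sAB|/subsetPn[a aA aB]] := boolP (A \subset B).
  have /eqP AB : A == B by rewrite eqEcard sAB cardAB leqnn.
  by rewrite AB fairB in nfair.
have [sBA|/subsetPn[b bB bA]] := boolP (B \subset A).
  have /eqP AB : B == A by rewrite eqEcard sBA cardAB leqnn.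
  by rewrite AB aA in aB.
apply: (IH (b |: A :\ a)) => //.
- apply: (@leq_trans #|A :\: B|) => //.
  rewrite (cardsD1 a (A :\: B)) !inE aA aB add1n ltnS.
  apply/subset_leq_card/subsetP => x; rewrite !inE.
  by case: (x =P b) => [->|_]; rewrite ?bB //= => /and3P[-> -> ->].
- by rewrite cardsU1 !inE (negPf bA) andbF -cardAB (cardsD1 a A) aA.
- exact: fair_exchange.
Qed.

(** The indices cross because [k] in [feasible_at] counts the goods outside the bundle: the owner of
    [s1] goods faces [s2] others. *)
Theorem fair_iff s1 s2 : (s1 + s2 = m)%N ->
  (exists A : {set 'I_m}, [/\ #|A| = s1, fair A & fair (~: A)]) <->
  (forall g, feasible_at s2 (v g) && feasible_at s1 (v g)).
Proof.
move=> sm; split=> [[A [cA fA fAC]] g|H].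
  have cAC : #|~: A| = s2 by have := cardsC A; rewrite card_ord cA; lia.
  have := fair_feasible (v_ge0 g) fA; have := fair_feasible (v_ge0 g) fAC.
  by rewrite setCK cA cAC => -> ->.
have [A cA fA] : exists2 A : {set 'I_m}, #|A| = s1 & fair A.
  by apply: (feasible_fair sm) => g; have /andP[] := H g.
have [B cB fB] : exists2 B : {set 'I_m}, #|B| = s2 & fair B.
  by apply: (@feasible_fair s2 s1) => [|g]; [rewrite addnC | have /andP[] := H g].
have cBC : #|~: B| = s1 by have := cardsC B; rewrite card_ord cB; lia.
(* [B] contents the second agent, so [~: B] has size [s1] and a fair complement: it is the target of
   the exchanges. *)
have [|||C [cC fC fCC]] := @fair_meet A (~: B); rewrite ?setCK ?cA ?cBC //.
by exists C; rewrite cC cBC.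
Qed.

End FairBundles.

(** * Reading and printing instances *)

Definition frac : Type := (nat * nat)%type.

Definition split_step (sep : symbol) (q : seq symbol * seq (seq symbol)) c :=
  if c == sep then ([::], rev q.1 :: q.2) else (c :: q.1, q.2).

(* The segments of [w] that are terminated by [sep], and the remainder. *)
Definition segments (sep : symbol) (w : seq symbol) : seq (seq symbol) * seq symbol :=
  let q := foldl (split_step sep) ([::], [::]) w in (rev q.2, rev q.1).

Arguments segments : simpl never.

(** Reading is total: malformed words give arbitrary values, and [decide] detects them by printing
    back. *)
Definition read_nat (w : seq symbol) : nat :=
  bits_val (map (fun c => c == Bit true) w).

Definition read_frac (w : seq symbol) : frac :=
  let q := segments Slash w in (read_nat (head [::] q.1), read_nat q.2).

Definition read_row (w : seq symbol) : seq frac :=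
  map read_frac (segments Comma w).1.

Definition table : Type := ((seq frac * seq frac) * (nat * nat))%type.

Definition read (w : seq symbol) : table :=
  let q := segments Semicolon w in
  let p := (segments Comma q.2).1 in
  ((read_row (head [::] q.1), read_row (head [::] (behead q.1))),
   (read_nat (head [::] p), read_nat (head [::] (behead p)))).

Definition print_frac (x : frac) : seq symbol :=
  binary x.1 ++ Slash :: binary x.2 ++ [:: Comma].

Definition print_row (r : seq frac) : seq symbol :=
  flatten (map print_frac r) ++ [:: Semicolon].

Definition print (d : table) : seq symbol :=
  print_row d.1.1 ++ print_row d.1.2 ++
  (binary d.2.1 ++ [:: Comma]) ++ (binary d.2.2 ++ [:: Comma]).

Lemma binaryE n :
  binary n = if bits n is b :: s then Bit b :: map Bit s else [:: Bit false].
Proof.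
rewrite /binary /bits; case: eqP => [->|_] //.
by rewrite /mkseq /= -map_comp.
Qed.

Lemma binary_sep (sep : symbol) n : (forall b, sep != Bit b) -> sep \notin binary n.
Proof. by move=> H; apply/mapP => -[k _ /eqP]; rewrite (negPf (H _)). Qed.

Lemma read_binary n : read_nat (binary n) = n.
Proof.
rewrite -[RHS]bitsK binaryE /read_nat; case: (bits n) => [|b s] //=.
congr (_ + _.*2); first by case: b.
by congr bits_val; rewrite -map_comp -[RHS]map_id; apply: eq_map; case.
Qed.

Lemma foldl_segments (sep : symbol) (x : seq symbol) r acc (w : seq symbol) :
  sep \notin x ->
  foldl (split_step sep) (r, acc) (x ++ w) =
  foldl (split_step sep) (catrev x r, acc) w.
Proof.
elim: x r => //= c x IH r; rewrite inE negb_or eq_sym => /andP[neq_c Hx].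
by rewrite -IH //; congr foldl; rewrite /split_step (negPf neq_c).
Qed.

Lemma segments_flatten (sep : symbol) (xs : seq (seq symbol)) (w : seq symbol) :
  all (fun x => sep \notin x) xs -> sep \notin w ->
  segments sep (flatten [seq x ++ [:: sep] | x <- xs] ++ w) = (xs, w).
Proof.
move=> Hxs Hw; rewrite /segments.
suff -> : foldl (split_step sep) ([::], [::])
    (flatten [seq x ++ [:: sep] | x <- xs] ++ w) = (rev w, rev xs).
  by rewrite /= !revK.
have H : forall acc, foldl (split_step sep) ([::], acc)
    (flatten [seq x ++ [:: sep] | x <- xs] ++ w) = (rev w, catrev xs acc).
  elim: xs Hxs => [_|x xs IH /andP[Hx /IH {}IH]] acc /=.
    by rewrite -[w]cats0 foldl_segments // cats0.
  rewrite -!catA foldl_segments //= {2}/split_step eqxx /= -/(rev x) revK.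
  exact: IH.
exact: H.
Qed.

Lemma print_fracE x :
  print_frac x = (binary x.1 ++ Slash :: binary x.2) ++ [:: Comma].
Proof. by rewrite -catA. Qed.

Lemma frac_sep (sep : symbol) x : (forall b, sep != Bit b) -> sep != Slash ->
  sep \notin binary x.1 ++ Slash :: binary x.2.
Proof.
move=> H1 H2; apply/negP; rewrite mem_cat (in_cons Slash) => /or3P[|/eqP E|].
- by rewrite (negPf (binary_sep _ H1)).
- by rewrite E eqxx in H2.
- by rewrite (negPf (binary_sep _ H1)).
Qed.

Lemma row_sep (r : seq frac) : Semicolon \notin flatten (map print_frac r).
Proof.
apply/flattenP => -[w /mapP[x _ ->]]; apply/negP.
by rewrite print_fracE mem_cat negb_or frac_sep.
Qed.

Lemma read_fracK x : read_frac (binary x.1 ++ Slash :: binary x.2) = x.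
Proof.
have := @segments_flatten Slash [:: binary x.1] (binary x.2).
rewrite /= cats0 -catA /= !binary_sep // /read_frac => ->//=.
by rewrite !read_binary; case: x.
Qed.

Lemma read_rowK r : read_row (flatten (map print_frac r)) = r.
Proof.
rewrite /read_row (eq_map print_fracE) (map_comp (fun x => x ++ [:: Comma])).
rewrite -[flatten _]cats0 segments_flatten //; last first.
  by apply/allP => _ /mapP[x _ ->]; apply: frac_sep.
rewrite -map_comp -[RHS]map_id; apply: eq_map => x /=; exact: read_fracK.
Qed.

(** No separator occurs inside the pieces that it delimits, so splitting at [Semicolon], then
    [Comma], then [Slash] undoes the printing. *)
Lemma printK : cancel print read.
Proof.
move=> [[r1 r2] [s1 s2]].
pose tl := flatten [seq x ++ [:: Comma] | x <- [:: binary s1; binary s2]] ++ [::].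
have E1 : segments Semicolon (print ((r1, r2), (s1, s2))) =
    ([:: flatten (map print_frac r1); flatten (map print_frac r2)], tl).
  transitivity (segments Semicolon (flatten [seq x ++ [:: Semicolon] |
      x <- [:: flatten (map print_frac r1); flatten (map print_frac r2)]] ++ tl)).
    by congr segments; rewrite /tl /print /print_row /= !cats0 -!catA.
  apply: segments_flatten; first by rewrite /= !row_sep.
  have -> : tl = (binary s1 ++ [:: Comma]) ++ (binary s2 ++ [:: Comma]).
    by rewrite /tl /= !cats0.
  by rewrite !mem_cat !mem_seq1 !negb_or !(@binary_sep Semicolon).
have E2 : segments Comma tl = ([:: binary s1; binary s2], [::]).
  by rewrite segments_flatten //= !binary_sep.
by rewrite /read E1 [(_, tl).2]/= E2 /= !read_rowK !read_binary.
Qed.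

(** * The decision procedure *)

(** Fractions are never reduced, which avoids computing common divisors; [polytime_frac_sum] shows
    that sums remain small enough. *)
Definition frac_add (x y : frac) : frac :=
  (x.1 * y.2 + y.1 * x.2, x.2 * y.2).
Definition frac_le (x y : frac) : bool := x.1 * y.2 <= y.1 * x.2.
Definition frac_max (x y : frac) : frac := if frac_le x y then y else x.
Definition frac_scale (k : nat) (x : frac) : frac := (k * x.1, x.2).
Definition frac_sum (r : seq frac) : frac := foldl frac_add (0, 1) r.

Definition feasible (r : seq frac) (k : nat) : bool :=
  all (fun t => frac_le (frac_add (frac_sum r) (frac_scale (2 * k) t))
    (frac_add (frac_scale 2 (frac_sum (map (fun x => frac_max x t) r))) t)) r.

(** The number of goods is the length of the first row. Utilities are compared by [frac_le] both
    ways because equal values may be written as different fractions. *)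
Definition accepts (d : table) : bool :=
  [&& 0 < size d.1.1, all2 (fun x y => frac_le x y && frac_le y x) d.1.1 d.1.2,
      all (fun x => 0 < x.2) d.1.1, all (fun x => 0 < x.2) d.1.2,
      (d.2.1 + d.2.2 <= size d.1.1) && (size d.1.1 <= d.2.1 + d.2.2),
      feasible d.1.1 d.2.2 & feasible d.1.1 d.2.1].

(* Printing back what was read checks that [w] is a well-formed encoding. *)
Definition decide (w : seq symbol) : bool :=
  all2 (fun a b => a == b) (print (read w)) w && accepts (read w).

(** * Polynomial running time of the decision procedure *)

Section PolyDecide.

Notation Encodable := (Encodable symbol).
Variables (A : Type) (eA : Encodable A).

Lemma polytime_segments sep (f : A -> seq symbol) :
  polytime f -> polytime (fun x => segments sep (f x)).
Proof.
move=> pf.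
have pq : polytime (fun x => foldl (split_step sep) ([::], [::]) (f x)).
  apply: (polytime_foldl_grow (g := fun=> 2) (f := fun _ => split_step sep)).
  - by pbound_tac.
  - move=> _ [s t] c; rewrite /split_step; case: eqP => _.
      by rewrite !sz_pair !sz_cons sz_nil /= sz_rev; lia.
    by rewrite /= !sz_pair !sz_cons sz_letter; lia.
  - apply: polytime_if; last by polytime_tac.
      by apply: (polytime_test (fun c => c == sep)); polytime_tac.
    by polytime_tac.
  - exact: polytime_const.
  - by [].
exact: polytime_pair (polytime_rev (polytime_snd pq)) (polytime_rev (polytime_fst pq)).
Qed.

Lemma polytime_read_nat (f : A -> seq symbol) :
  polytime f -> polytime (fun x => read_nat (f x)).
Proof.
move=> pf; apply/polytime_bits_val/polytime_map => //.
by apply: (polytime_test (fun c => c == Bit true)); polytime_tac.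
Qed.

Lemma polytime_binary (f : A -> nat) :
  polytime f -> polytime (fun x => binary (f x)).
Proof.
move=> pf; have pB B (eB : Encodable B) (g : B -> bool) :
    polytime g -> polytime (fun x => Bit (g x)).
  move=> pg; apply: (@polytime_eq _ _ _ _ _
    (fun x => if g x then Bit true else Bit false)) => [x|].
    by case: (g x).
  by apply: polytime_if pg _ _; apply: polytime_const.
apply: (@polytime_eq _ _ _ _ _ (fun x => if bits (f x) is b :: s then
    Bit b :: map Bit s else [:: Bit false])) => [x|].
  by rewrite binaryE.
apply: polytime_case; first exact: polytime_bits.
  apply: polytime_cons; first by apply: pB; polytime_tac.
  apply: polytime_map; last by polytime_tac.
  by apply: pB; polytime_tac.
exact: polytime_const.
Qed.

Lemma polytime_frac_add (f g : A -> frac) :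
  polytime f -> polytime g -> polytime (fun x => frac_add (f x) (g x)).
Proof. by move=> pf pg; rewrite /frac_add; polytime_tac. Qed.

Lemma polytime_frac_le (f g : A -> frac) :
  polytime f -> polytime g -> polytime (fun x => frac_le (f x) (g x)).
Proof. by move=> pf pg; rewrite /frac_le; polytime_tac. Qed.

Lemma polytime_frac_scale (f : A -> nat) (g : A -> frac) :
  polytime f -> polytime g -> polytime (fun x => frac_scale (f x) (g x)).
Proof. by move=> pf pg; rewrite /frac_scale; polytime_tac. Qed.

Lemma polytime_frac_max (f g : A -> frac) :
  polytime f -> polytime g -> polytime (fun x => frac_max (f x) (g x)).
Proof. by move=> pf pg; rewrite /frac_max /frac_le; polytime_tac. Qed.

End PolyDecide.

(* The size of the whole fraction could double at each step, but the maximum of the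
   sizes of numerator and denominator grows additively. *)
Lemma polytime_frac_sum A {eA : Encodable symbol A} (f : A -> seq frac) :
  polytime f -> polytime (fun x => frac_sum (f x)).
Proof.
move=> pf.
apply: (@polytime_foldl_mu symbol frac A frac _ _ _
  (fun x => maxn (@sz symbol _ _ x.1) (@sz symbol _ _ x.2))
  (fun n => n + 2) (fun n => 2 * n + 1) (fun _ => frac_add) (fun=> (0, 1))).
- by pbound_tac.
- by pbound_tac.
- move=> e [a b] [c d]; rewrite sz_pair /frac_add /= !sz_nat.
  have := size_bitsD (a * d) (c * b); have := size_bitsM a d.
  by have := size_bitsM c b; have := size_bitsM b d; lia.
- by move=> [a b]; rewrite sz_pair /=; lia.
- by apply: polytime_frac_add; polytime_tac.
- exact: polytime_const.
- by [].
Qed.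

Lemma polytime_feasible A {eA : Encodable symbol A} (f : A -> seq frac) (g : A -> nat) :
  polytime f -> polytime g -> polytime (fun x => feasible (f x) (g x)).
Proof.
move=> pf pg; have psum := polytime_frac_sum pf.
apply: polytime_all => //.
have pf2 : polytime (fun q : frac * A => f q.2).
  by apply: (polytime_comp pf); polytime_tac.
have pg2 : polytime (fun q : frac * A => g q.2).
  by apply: (polytime_comp pg); polytime_tac.
apply: polytime_frac_le; apply: polytime_frac_add.
- exact: polytime_frac_sum.
- by apply: polytime_frac_scale; polytime_tac.
- apply: polytime_frac_scale; first exact: polytime_const.
  apply: polytime_frac_sum; apply: polytime_map => //.
  by apply: polytime_frac_max; polytime_tac.
- by polytime_tac.
Qed.

Lemma polytime_accepts A {eA : Encodable symbol A} (f : A -> table) :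
  polytime f -> polytime (fun x => accepts (f x)).
Proof.
move=> pf; rewrite /accepts.
have pr1 : polytime (fun x => (f x).1.1) by polytime_tac.
have pr2 : polytime (fun x => (f x).1.2) by polytime_tac.
repeat apply: polytime_andb; try by polytime_tac.
- apply: polytime_all2 => //.
  by apply: polytime_andb; apply: polytime_frac_le; polytime_tac.
- by apply: polytime_all => //; polytime_tac.
- by apply: polytime_all => //; polytime_tac.
- by apply: polytime_feasible; polytime_tac.
- by apply: polytime_feasible; polytime_tac.
Qed.

Lemma polytime_read_row A {eA : Encodable symbol A} (f : A -> seq symbol) :
  polytime f -> polytime (fun x => read_row (f x)).
Proof.
move=> pf; apply: polytime_map; last exact/polytime_fst/polytime_segments.
have ps : polytime (fun q : seq symbol * A => segments Slash q.1).
  by apply: polytime_segments; polytime_tac.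
by apply: polytime_pair; apply: polytime_read_nat; polytime_tac.
Qed.

Lemma polytime_read A {eA : Encodable symbol A} (f : A -> seq symbol) :
  polytime f -> polytime (fun x => read (f x)).
Proof.
move=> pf; have ps := polytime_segments Semicolon pf.
have pc := polytime_segments Comma (polytime_snd ps).
apply: polytime_pair; apply: polytime_pair.
- by apply: polytime_read_row; polytime_tac.
- by apply: polytime_read_row; polytime_tac.
- by apply: polytime_read_nat; polytime_tac.
- by apply: polytime_read_nat; polytime_tac.
Qed.

Lemma polytime_print_row A {eA : Encodable symbol A} (f : A -> seq frac) :
  polytime f -> polytime (fun x => print_row (f x)).
Proof.
move=> pf; apply: polytime_cat; last exact: polytime_const.
apply: polytime_flatten; apply: polytime_map => //.
apply: polytime_cat; first by apply: polytime_binary; polytime_tac.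
apply: polytime_cons; first exact: polytime_const.
by apply: polytime_cat; [apply: polytime_binary; polytime_tac | apply: polytime_const].
Qed.

Lemma polytime_print A {eA : Encodable symbol A} (f : A -> table) :
  polytime f -> polytime (fun x => print (f x)).
Proof.
move=> pf; apply: polytime_cat; first by apply: polytime_print_row; polytime_tac.
apply: polytime_cat; first by apply: polytime_print_row; polytime_tac.
by apply: polytime_cat; apply: polytime_cat; try exact: polytime_const;
  apply: polytime_binary; polytime_tac.
Qed.

Lemma polytime_decide : polytime decide.
Proof.
have pr := polytime_read (@polytime_id symbol (seq symbol) _).
apply: polytime_andb; last exact: polytime_accepts.
apply: polytime_all2; [ | exact: polytime_print | exact: polytime_id].
by apply: polytime_eqletter; polytime_tac.
Qed.

(** * Correctness *)

Section Correctness.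

Local Open Scope ring_scope.

Variable R : realFieldType.

Definition frac_val (x : frac) : R := x.1%:R / x.2%:R.

Lemma frac_val_ge0 x : 0 <= frac_val x.
Proof. by rewrite divr_ge0. Qed.

Lemma frac_leE x y : (0 < x.2)%N -> (0 < y.2)%N ->
  frac_le x y = (frac_val x <= frac_val y).
Proof.
move=> x0 y0; rewrite /frac_val ler_pdivrMr ?ltr0n // mulrAC.
by rewrite ler_pdivlMr ?ltr0n // -!natrM ler_nat.
Qed.

Lemma frac_val_add x y : (0 < x.2)%N -> (0 < y.2)%N ->
  frac_val (frac_add x y) = frac_val x + frac_val y.
Proof.
move=> x0 y0; rewrite /frac_val /frac_add /= natrD !natrM.
by field; rewrite !pnatr_eq0 -!lt0n x0 y0.
Qed.

Lemma frac_val_scale k x : frac_val (frac_scale k x) = k%:R * frac_val x.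
Proof. by rewrite /frac_val /= natrM mulrA. Qed.

Lemma frac_val_max x y : (0 < x.2)%N -> (0 < y.2)%N ->
  frac_val (frac_max x y) = Num.max (frac_val x) (frac_val y).
Proof.
move=> x0 y0; rewrite /frac_max frac_leE //.
by case: leP.
Qed.

Lemma frac_max_gt0 x y : (0 < x.2)%N -> (0 < y.2)%N -> (0 < (frac_max x y).2)%N.
Proof. by rewrite /frac_max; case: ifP. Qed.

Lemma frac_add_gt0 x y : (0 < x.2)%N -> (0 < y.2)%N -> (0 < (frac_add x y).2)%N.
Proof. by move=> x0 y0; rewrite muln_gt0 x0. Qed.

Lemma frac_sumP (r : seq frac) : all (fun x => 0 < x.2)%N r ->
  (0 < (frac_sum r).2)%N /\ frac_val (frac_sum r) = \sum_(x <- r) frac_val x.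
Proof.
rewrite /frac_sum => Hr.
have H : forall z, (0 < z.2)%N -> (0 < (foldl frac_add z r).2)%N /\
    frac_val (foldl frac_add z r) = frac_val z + \sum_(x <- r) frac_val x.
  elim: r Hr => [_|x r IH /= /andP[x0 /IH {}IH]] z z0.
    by rewrite big_nil addr0.
  have [H1 H2] := IH _ (frac_add_gt0 z0 x0).
  by rewrite H2 frac_val_add // big_cons addrA.
have [H1 ->] := H (0, 1)%N isT; split=> //.
by rewrite /frac_val mul0r add0r.
Qed.

Lemma frac_sum_enum m (a : 'I_m -> frac) : (forall g, 0 < (a g).2)%N ->
  (0 < (frac_sum (map a (enum 'I_m))).2)%N /\
  frac_val (frac_sum (map a (enum 'I_m))) = \sum_g frac_val (a g).
Proof.
move=> a0; have [|H ->] := @frac_sumP (map a (enum 'I_m)).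
  by apply/allP => _ /mapP[g _ ->].
by split; rewrite // big_map big_enum.
Qed.

Lemma frac_feasibleE x y t k : (0 < x.2)%N -> (0 < y.2)%N -> (0 < t.2)%N ->
  frac_le (frac_add x (frac_scale (2 * k) t)) (frac_add (frac_scale 2 y) t) =
  (frac_val x + k.*2%:R * frac_val t <= 2 * frac_val y + frac_val t).
Proof.
move=> x0 y0 t0.
have h1 : (0 < (frac_add x (frac_scale (2 * k) t)).2)%N by apply: frac_add_gt0.
have h2 : (0 < (frac_add (frac_scale 2 y) t).2)%N by apply: frac_add_gt0.
by rewrite (frac_leE h1 h2) frac_val_add // frac_val_add // !frac_val_scale mul2n.
Qed.

Lemma feasibleE m (a : 'I_m -> frac) k : (forall g, 0 < (a g).2)%N ->
  feasible (map a (enum 'I_m)) k =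
  [forall g, feasible_at (fun h => frac_val (a h)) k (frac_val (a g))].
Proof.
move=> a0; rewrite /feasible all_map.
transitivity (all (fun g =>
    feasible_at (fun h => frac_val (a h)) k (frac_val (a g))) (enum 'I_m)).
  apply: eq_all => g /=; rewrite -map_comp.
  have [s0 sE] := frac_sum_enum a0.
  have [|m0 mE] := @frac_sum_enum _ (fun h => frac_max (a h) (a g)).
    by move=> h; apply: frac_max_gt0.
  rewrite (frac_feasibleE k s0 m0 (a0 g)) sE mE.
  rewrite /feasible_at; congr (_ <= _ * _ + _).
  by apply: eq_bigr => h _; rewrite frac_val_max.
apply/allP/forallP => [H g|H g _]; last exact: H.
by apply: H; rewrite mem_enum.
Qed.

(** * Allocations between two agents as single bundles *)

Lemma ord2P (i : 'I_2) : i = ord0 \/ i = ord_max.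
Proof. by case: i => [[|[|//]] p]; [left | right]; apply/val_inj. Qed.

Lemma fair_EF1 m (I : instance R 2 m) (A : 'I_2 -> {set 'I_m}) i j :
  identical I -> A j = ~: A i ->
  (EF1_towards I A i j <-> fair (fun g => util I ord0 [set g]) (A i)).
Proof.
move=> idI Aj.
have valE B : util I i B = value (fun g => util I ord0 [set g]) B.
  by rewrite (idI i ord0) util_additive.
rewrite /EF1_towards Aj /fair; split.
  case=> [->|[g gA le_g]]; first by rewrite eqxx.
  apply/orP; right; apply/existsP; exists g.
  by rewrite -!valE le_g andbT; rewrite inE in gA.
case/orP => [/eqP->|/existsP[g /andP[gA le_g]]]; first by left.
by right; exists g; rewrite ?inE // !valE.
Qed.

(** The first bundle determines the allocation, the second one being its complement; by [fair_EF1],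
    the two EF1 conditions become fairness of the bundle and of its complement. *)
Lemma reformableP m (I : instance R 2 m) (s : 'I_2 -> nat)
    (v := fun g => util I ord0 [set g]) :
  identical I -> (s ord0 + s ord_max = m)%N ->
  reformable I s <->
  exists A : {set 'I_m}, [/\ #|A| = s ord0, fair v A & fair v (~: A)].
Proof.
move=> idI sm; split=> [[A [[dis cov] szA efA]]|[B [szB fB fBC]]].
  have A1 : A ord_max = ~: A ord0.
    apply/setP => x; rewrite inE; apply/idP/idP => [x1|x0].
      apply/negP => x0; have := dis ord0 ord_max isT.
      by rewrite disjoint_sym => /disjointFr/(_ x1); rewrite x0.
    have : x \in \bigcup_i A i by rewrite cov inE.
    by case/bigcupP => i _; case: (ord2P i) => -> //; rewrite (negPf x0).
  have A0 : A ord0 = ~: A ord_max by rewrite A1 setCK.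
  exists (A ord0); split=> //.
    by apply/(fair_EF1 idI A1)/efA.
  by rewrite -A1; apply/(fair_EF1 idI A0)/efA.
pose A (i : 'I_2) := if i == ord0 then B else ~: B.
have A1 : A ord_max = ~: A ord0 by [].
have A0 : A ord0 = ~: A ord_max by rewrite A1 setCK.
have AE : A ord0 = B by [].
exists A; split.
- split=> [i j|].
    by case: (ord2P i) => ->; case: (ord2P j) => -> // _;
      rewrite A1 AE -setI_eq0 ?setICr // setIC setICr.
  apply/setP => x; rewrite inE; apply/bigcupP.
  by have [xB|xB] := boolP (x \in B); [exists ord0 | exists ord_max] => //;
    rewrite ?A1 AE ?inE.
- move=> i; case: (ord2P i) => ->; rewrite ?A1 AE //.
  by have := cardsC B; rewrite card_ord szB; lia.
- move=> i j; case: (ord2P i) => ->; case: (ord2P j) => -> // _.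
    exact/(fair_EF1 idI A1).
  by apply/(fair_EF1 idI A0); rewrite A1.
Qed.

(** * Words, tables and instances *)

Lemma enum_ord2 : enum 'I_2 = [:: ord0; ord_max].
Proof. by apply: (inj_map val_inj); rewrite val_enum_ord. Qed.

Definition row_of m (num den : 'I_2 -> 'I_m -> nat) (i : 'I_2) (g : 'I_m) : frac :=
  (num i g, den i g).

Definition table_of m (num den : 'I_2 -> 'I_m -> nat) (s : 'I_2 -> nat) : table :=
  ((map (row_of num den ord0) (enum 'I_m), map (row_of num den ord_max) (enum 'I_m)),
   (s ord0, s ord_max)).

Lemma encoding_print m (num den : 'I_2 -> 'I_m -> nat) s :
  encoding num den s = print (table_of num den s).
Proof.
rewrite /encoding enum_ord2 /= !cats0 /print /print_row /= -!map_comp.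
by rewrite -!catA.
Qed.

Lemma all2_mapE (S T U : Type) (r : T -> U -> bool) (a : S -> T) (b : S -> U) l :
  all2 r (map a l) (map b l) = all (fun x => r (a x) (b x)) l.
Proof. by elim: l => //= x l ->. Qed.

Lemma accepts_table m (num den : 'I_2 -> 'I_m -> nat) s (I : instance R 2 m) :
  (0 < m)%N -> (s ord0 + s ord_max = m)%N -> identical I ->
  (forall i g, (0 < den i g)%N /\
     util I i [set g] = (num i g)%:R / (den i g)%:R) ->
  accepts (table_of num den s) <-> reformable I s.
Proof.
move=> m0 sm idI H.
have den0 i g : (0 < (row_of num den i g).2)%N by case: (H i g).
have valE i g : util I ord0 [set g] = frac_val (row_of num den i g).
  by rewrite (idI ord0 i); case: (H i g).
apply: iff_trans (iff_sym (reformableP idI sm)).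
apply: iff_trans (iff_sym (fair_iff (fun g => util_ge0 I ord0 [set g]) sm)).
have pos i : all (fun x => 0 < x.2)%N (map (row_of num den i) (enum 'I_m)).
  by apply/allP => _ /mapP[g _ ->].
have eqr : all2 (fun x y => frac_le x y && frac_le y x)
    (map (row_of num den ord0) (enum 'I_m)) (map (row_of num den ord_max) (enum 'I_m)).
  by rewrite all2_mapE; apply/allP => g _; rewrite !frac_leE // -!valE lexx.
rewrite /accepts [_.1]/= [_.2]/= size_map size_enum_ord m0 !pos eqr.
rewrite -[(_, _).1]/(s ord0) -[(_, _).2]/(s ord_max) sm leqnn /= !feasibleE //.
have feasE k t : feasible_at (fun h => frac_val (row_of num den ord0 h)) k t =
    feasible_at (fun g => util I ord0 [set g]) k t.
  rewrite /feasible_at; congr (_ + _ <= _ * _ + _); apply: eq_bigr => g _;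
  by rewrite (valE ord0).
split=> [/andP[/forallP H1 /forallP H2] g|H1].
  by have := H1 g; have := H2 g; rewrite !feasE -!valE => -> ->.
apply/andP; split; apply/forallP => g; have /andP[] := H1 g;
by rewrite !feasE -!valE.
Qed.

(** The checks in [accepts] are what is needed to build an instance: equal row lengths, positive
    denominators, equal values in both rows, and sizes that add up to [m]. Utilities of bundles are
    defined as sums. *)
Lemma table_instance (d : table) : accepts d ->
  exists (m : nat) (num den : 'I_2 -> 'I_m -> nat) (s : 'I_2 -> nat)
    (I : instance R 2 m),
  [/\ (0 < m)%N /\ (s ord0 + s ord_max = m)%N, identical I,
     (forall i g, (0 < den i g)%N /\
       util I i [set g] = (num i g)%:R / (den i g)%:R) &
     d = table_of num den s].
Proof.
case: d => [[r1 r2] [s1 s2]]; rewrite /accepts /=.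
case/and5P => r0 eq_r pos1 pos2 /andP[/andP[le1 le2] _].
have sz2 : size r1 = size r2 by move: eq_r; rewrite all2E => /andP[/eqP].
pose m := size r1.
pose r (i : 'I_2) := if i == ord0 then r1 else r2.
have szr i : size (r i) = m by rewrite /r; case: ifP.
(* This default is never returned, as both rows have length [m]; its denominator 0 would not be a
   legal one. *)
pose x0 : frac := (0, 0)%N.
pose num i (g : 'I_m) := (nth x0 (r i) g).1.
pose den i (g : 'I_m) := (nth x0 (r i) g).2.
pose s (i : 'I_2) := if i == ord0 then s1 else s2.
have nth_mem' i (g : 'I_m) : nth x0 (r i) g \in r i.
  by rewrite mem_nth // szr.
have den0 i g : (0 < den i g)%N.
  have : all (fun x => 0 < x.2)%N (r i) by rewrite /r; case: ifP.
  by move/allP/(_ _ (nth_mem' i g)).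
pose v (i : 'I_2) (g : 'I_m) : R := frac_val (nth x0 (r i) g).
have vE i (g : 'I_m) : v i g = v ord0 g.
  case: (ord2P i) => -> //; rewrite /v /r /=.
  have: (0 < (nth x0 r1 g).2)%N := den0 ord0 g.
  have: (0 < (nth x0 r2 g).2)%N := den0 ord_max g.
  move=> d2 d1; apply/eqP; rewrite eq_le -!frac_leE //.
  move: eq_r; rewrite all2E => /andP[_ /allP].
  move/(_ (nth x0 r1 g, nth x0 r2 g)) => /= le12.
  have /le12/andP[-> ->] // : (nth x0 r1 g, nth x0 r2 g) \in zip r1 r2.
  by rewrite -nth_zip // mem_nth // size_zip -sz2 minnn.
pose u (i : 'I_2) (B : {set 'I_m}) : R := \sum_(g in B) v i g.
have u0 i B : 0 <= u i B by apply: sumr_ge0 => g _; apply: frac_val_ge0.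
have uD i B : u i B = \sum_(g in B) u i [set g].
  by apply: eq_bigr => g _; rewrite /u big_set1.
exists m, num, den, s, (Instance u0 uD); split=> //.
- by split=> //; apply/eqP; rewrite eqn_leq le1.
- by move=> i j B /=; apply: eq_bigr => g _; rewrite vE [RHS]vE.
- by move=> i g; split; [apply: den0 | rewrite /= /u big_set1].
have rowE i : map (row_of num den i) (enum 'I_m) = r i.
  transitivity (mkseq (nth x0 (r i)) m); last by rewrite -(szr i) mkseq_nth.
  rewrite /mkseq -val_enum_ord -map_comp; apply: eq_map => g /=.
  by rewrite /row_of /num /den; case: nth.
by rewrite /table_of !rowE.
Qed.

(** A word that survives printing back is the encoding of its table, and conversely [printK] makes
    every encoding pass. The procedure works on natural numbers only, so it is the same for every
    field [R]. *)
Lemma decide_correct w :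
  decide w <-> Reformability (@two_identical_agents R) w.
Proof.
have eqP2 (s t : seq symbol) : all2 (fun a b => a == b) s t = (s == t).
  by rewrite -eqseq_all.
rewrite /decide eqP2; split.
  case/andP => /eqP Ew acc; have [m [num [den [s [I]]]]] := table_instance acc.
  case=> -[m0 sm] idI HI Ed; rewrite -Ew Ed.
  exists 2%N, m, I, s; split=> //.
  - rewrite /size_vector big_ord_recr /= big_ord1 -sm.
    by congr (s _ + _)%N; apply/val_inj.
  - by exists num, den; rewrite encoding_print.
  - by apply/(accepts_table m0 sm idI HI); rewrite -Ed.
case=> n [m [I [s [[_ m0] sm [n2 idI] [num [den [HI ->]]] ref]]]].
subst n; rewrite encoding_print printK eqxx /=.
have sm' : (s ord0 + s ord_max = m)%N.
  by rewrite -sm big_ord_recr /= big_ord1; congr (s _ + _)%N; apply/val_inj.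
exact/(accepts_table m0 sm' idI HI).
Qed.

End Correctness.

Theorem theorem3p2 (R : realFieldType) :
  in_P (Reformability (@two_identical_agents R)).
Proof.
have [M [c [k H]]] := polytime_in_P polytime_decide.
exists M, c, k => w; have [b [ans iff_b]] := H w.
by exists b; split=> //; apply: iff_trans iff_b (decide_correct R w).
Qed.
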